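(* Let $b>-1$ and assume that the radius distribution satisfies $f(r)=\min\{\frac{\ln^{b}(r)}{r},1\}$. Then the sequence $(f(n)\tau_n)_n$ is tight. Moreover, for every subsequence $(n_k)_k$ such that $f(n_k)T_{n_k}\Longrightarrow Y$ in distribution, the limit $Y$ (which may depend on $f$ and $(n_k)_k$) is a non-degenerate distribution with compact support.
   Context: Covering process: let $R$ be a random variable with values in $\{1,2,\dots\}$ and $f(r)=\mathbb{P}(R\ge r)$ for real $r\ge 1$. For $n\ge1$ consider the discrete torus $\mathbb{Z}/n\mathbb{Z}=\{0,\dots,n-1\}$. Let $(R_k)_{k\ge1}$ be i.i.d. copies of $R$ and $(U_k)_{k\ge1}$ i.i.d. uniform on $\mathbb{Z}/n\mathbb{Z}$, independent. The $k$-th object is $\mathcal{O}_k=\{U_k,U_k+1,\dots,U_k+R_k-1\}$ (mod $n$). Set $C_0=\emptyset$, $C_k=C_{k-1}\cup\mathcal{O}_k$, and the discrete cover time $\tau_n=\min\{k: C_k=\mathbb{Z}/n\mathbb{Z}\}$. With $(N(t))_{t\ge0}$ an independent rate-one Poisson process, $X_t=C_{N(t)}$ and $T_n=\inf\{t: X_t=\mathbb{Z}/n\mathbb{Z}\}$. A distribution is non-degenerate if it is not concentrated on a single point; the support of a law $Y$ is the set of $y\in\mathbb{R}$ such that every neighbourhood of $y$ has positive probability. *)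

(* Defs.v *)
From HB Require Import structures.
From mathcomp Require Import all_boot all_order all_algebra.
From mathcomp Require Import all_classical all_reals all_analysis.
Set Implicit Arguments. Unset Strict Implicit. Unset Printing Implicit Defensive.
Import Order.TTheory GRing.Theory Num.Theory.
Import numFieldNormedType.Exports.
Local Open Scope classical_set_scope.
Local Open Scope ring_scope.

Section Covering.
Context {R : realType} {d : measure_display} {Omega : measurableType d}.
Variable P : probability Omega R.

(* Index set of the random inputs: (inl k) = R_k, (inr (inl k)) = U_k,
   (inr (inr k)) = E_k (k-th interarrival time of the Poisson process). *)
Definition idx := (nat + (nat + nat))%type.

Definition mutually_independent {I : eqType} (G : I -> set (set Omega)) :=
  forall (J : seq I) (A : I -> set Omega), uniq J ->
    (forall i, i \in J -> G i (A i)) ->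
    P (\big[setI/setT]_(i <- J) A i) = (\prod_(i <- J) P (A i))%E.

(* Events generated by the random variables (objects are indexed from 0:
   the k-th object of the paper uses Rv (k-1), U n (k-1)). *)
Definition gen_events (Rv : nat -> Omega -> nat) (U : nat -> Omega -> nat)
  (E : nat -> Omega -> R) (i : idx) : set (set Omega) :=
  match i with
  | inl k => [set Rv k @^-1` A | A in [set: set nat]]
  | inr (inl k) => [set U k @^-1` A | A in [set: set nat]]
  | inr (inr k) => [set E k @^-1` A | A in [set A : set R | measurable A]]
  end.

Definition tailR (Rv : nat -> Omega -> nat) (r : nat) : R :=
  fine (P [set w | (r <= Rv 0%N w)%N]).

Definition covering_model (n : nat) (Rv : nat -> Omega -> nat)
  (U : nat -> Omega -> nat) (E : nat -> Omega -> R) : Prop :=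
  (forall k w, (0 < Rv k w)%N) /\
  [/\ 
      (forall k (A : set nat), measurable (Rv k @^-1` A) /\
           P (Rv k @^-1` A) = P (Rv 0%N @^-1` A)),
      (forall k w, (U k w < n)%N),
      (forall k j, (j < n)%N -> measurable (U k @^-1` [set j]) /\
           P (U k @^-1` [set j]) = (n%:R^-1)%:E),
      (forall k, measurable_fun setT (E k) /\
         forall x : R, 0 <= x -> P [set w | x < E k w] = (expR (- x))%:E) &
      mutually_independent (gen_events Rv U E)].

Definition covered (n : nat) (Rv U : nat -> Omega -> nat) (w : Omega)
  (k : nat) : Prop :=
  forall x, (x < n)%N -> exists2 i, (i < k)%N &
    exists2 j, (j < Rv i w)%N & x = ((U i w + j) %% n)%N.

(* discrete cover time tau_n = min {k : C_k = Z/nZ} (+oo if no such k) *)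
Definition tau (n : nat) (Rv U : nat -> Omega -> nat) (w : Omega) : \bar R :=
  ereal_inf [set (k%:R)%:E | k in [set k | covered n Rv U w k]].

Definition arrival (E : nat -> Omega -> R) (m : nat) (w : Omega) : R :=
  \sum_(i < m) E i w.
Definition PoissonN (E : nat -> Omega -> R) (t : R) (w : Omega) : \bar R :=
  (\esum_(m in [set m : nat | (0 < m)%N /\ (arrival E m w <= t)%R]) 1)%E.

(* X_t = C_{N(t)} = Z/nZ  (C is increasing in k) *)
Definition Xfull (n : nat) (Rv U : nat -> Omega -> nat) (E : nat -> Omega -> R)
  (t : R) (w : Omega) : Prop :=
  exists k : nat, ((k%:R)%:E <= PoissonN E t w)%E /\ covered n Rv U w k.

Definition Tcont (n : nat) (Rv U : nat -> Omega -> nat) (E : nat -> Omega -> R)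
  (w : Omega) : \bar R :=
  ereal_inf [set t%:E | t in [set t : R | 0 <= t /\ Xfull n Rv U E t w]].

End Covering.

Definition cvg_in_distribution {R : realType} {d : measure_display}
  {Omega : measurableType d} (P : probability Omega R)
  (Z : nat -> Omega -> \bar R) (Y : probability R R) : Prop :=
  forall x : R, Y [set x] = 0%E ->
    (fun k => P [set w | (Z k w <= x%:E)%E]) @ \oo --> Y [set y : R | y <= x].

Definition law_support {R : realType} (Y : probability R R) : set R :=
  [set y | forall e : R, 0 < e -> (0 < Y (ball y e))%E].

Definition non_degenerate {R : realType} (Y : probability R R) : Prop :=
  ~ exists c : R, Y [set c] = 1%E.

(* Main.v *)
(** The time axis is split off first: up to events of probability 2^-k, the k-th
    arrival lies between k/32 and 6k, so everything reduces to the number of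
    objects thrown.  The first object of radius at least n covers the torus,
    which gives tightness, and makes T_n small on the scale 1/f(n) with positive
    probability.  By Karamata's estimate the sum of f over (0, n] is of order
    n f(n) ln n, so after K/f(n) objects with K large the expected number of
    uncovered points tends to 0; hence limits are bounded.  For small K the
    second moment of that number is comparable to the square of its mean,
    because sum_{h<j<=n} f(j) = O(n f(n) (1 + ln (n/(h+1)))): two points at
    distance h are positively correlated by at most a factor sqrt(n/(h+1)),
    which is summable in the mean over h.  Hence limits are not the point mass
    at 0. *)
Require Import Defs.
From HB Require Import structures.
From mathcomp Require Import all_boot all_order all_algebra.
From mathcomp Require Import all_classical all_reals all_analysis measurable_realfun.
From mathcomp Require Import ring lra zify.
Set Implicit Arguments. Unset Strict Implicit. Unset Printing Implicit Defensive.
Import Order.TTheory GRing.Theory Num.Theory.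
Import numFieldNormedType.Exports.
Local Open Scope classical_set_scope.
Local Open Scope ring_scope.

(** * Elementary inequalities for logarithms, harmonic sums and powers *)

Section RegularVariation.
Context {R : realType}.
Implicit Types (b x y L : R).

(** Why both mechanisms live on the scale [1 / f n]: an object of radius at least [n] has
    probability [f n], while an object hits a given point with probability [p] of order
    [f n * ln n]. After [K / f n] objects the mean number of missed points, about
    [n * expR (- (K / f n) * p)], is thus squeezed between two powers of [n] whose exponents are
    affine and decreasing in [K]: it vanishes for large [K] and explodes for small [K]. The
    assumption [-1 < b] enters through the upper bound on tail sums: [ln^b r / r] has the primitive
    [ln^(b+1) r / (b+1)], and for negative [b] the increments of [ln^(b+1)] have to dominate it.
    Radii are unbounded, but truncating them at [n] does not change the covering, so [k] objects
    form a point of a finite space and all moments are finite sums over it. Boundedness and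
    non-degeneracy of a limit survive a change of time by a constant factor. This is why the Poisson
    clock is controlled by crude union bounds and why no constant is optimised. *)

Lemma powR_expR b x : 0 < x -> x `^ b = expR (b * ln x).
Proof. by move=> x0; rewrite /powR gt_eqF. Qed.

Lemma ln_nat_ge1 n : (4 <= n)%N -> 1 <= ln (n%:R : R).
Proof.
move=> n4; rewrite -ler_expR lnK ?posrE ?ltr0n; last lia.
have : (4%:R : R) <= n%:R by rewrite ler_nat.
(* This is [e <= 4]: the tangent bound at [- 2^-1] gives [expR 2^-1 <= 2], which is then squared. *)
apply: le_trans; have h : 2^-1 <= expR (- 2^-1) :> R.
  by apply: le_trans (expR_ge1Dx _); lra.
have -> : (1 : R) = 2^-1 * 2%:R by rewrite mulVf.
rewrite expRM_natr; rewrite expRN in h.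
have e0 := expR_gt0 (2^-1 : R).
have : expR 2^-1 <= 2 :> R by rewrite -[leLHS]invrK invf_ple ?posrE ?invr_gt0.
rewrite expr2; nra.
Qed.

Lemma ln_diff_ge x y : 0 < x -> 0 < y -> 1 - x / y <= ln y - ln x.
Proof.
move=> x0 y0; rewrite -ln_div ?posrE//.
have yx0 : 0 < x / y by rewrite divr_gt0.
have -> : y / x = (x / y)^-1 by rewrite invf_div.
rewrite lnV ?posrE//; have := @le_ln1Dx R (x / y - 1).
by rewrite addrCA subrr addr0 => H; have {}H := H ltac:(lra); lra.
Qed.

Lemma inv_le_ln_diff n : (1 < n)%N -> n%:R^-1 <= ln (n%:R : R) - ln (n.-1%:R).
Proof.
case: n => [//|[//|n]] _ /=.
apply: le_trans (ln_diff_ge _ _) => //.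
have n0 : n.+2%:R != 0 :> R by [].
by rewrite -[X in X - _](divff n0) -mulrBl -natrB// subSnn mul1r.
Qed.

Lemma ln_diff_le_inv n : (0 < n)%N -> ln (n.+1%:R : R) - ln (n%:R) <= n%:R^-1.
Proof.
case: n => [//|n] _.
have := @ln_diff_ge n.+2%:R n.+1%:R (ltr0Sn _ _) (ltr0Sn _ _).
have n0 : n.+1%:R != 0 :> R by [].
have -> : n.+2%:R / n.+1%:R = 1 + n.+1%:R^-1 :> R.
  by rewrite -[n.+2]addn1 natrD mulrDl divff// mul1r.
set v := n.+1%:R^-1; lra.
Qed.

(** The first term is split off and paid for by the [1]: comparing [j^-1] with an increment of [ln]
    needs [j > 1], and [h] may be 0. *)
Lemma sum_inv_le h n : (h <= n)%N ->
  \sum_(h.+1 <= j < n.+1) (j%:R^-1 : R) <= 1 + ln n%:R - ln h.+1%:R.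
Proof.
move=> hn; have [->|hn'] := eqVneq h n.
  rewrite big_geq//; have := @ln_diff_le_inv n; case: n {hn} => [|n] H.
    by rewrite ln0// ln1; lra.
  have {}H := H isT; have : n.+1%:R^-1 <= 1 :> R by rewrite invf_le1// ler1n.
  by set v := (n.+1%:R^-1 : R) in H *; lra.
have {hn hn'}hn : (h < n)%N by rewrite ltn_neqAle hn' hn.
rewrite big_ltn//.
have : \sum_(h.+2 <= j < n.+1) (j%:R^-1 : R) <= ln n%:R - ln h.+1%:R.
  rewrite -[leRHS](telescope_sumr (fun j => ln (j%:R : R)))//.
  rewrite big_add1/= !big_nat; apply: ler_sum => j /andP[hj jn].
  by apply: (@inv_le_ln_diff j.+1); lia.
have : h.+1%:R^-1 <= 1 :> R by rewrite invf_le1// ler1n.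
by set v := (h.+1%:R^-1 : R); lra.
Qed.

(** The tangent at 1 of a concave power, read off Young's inequality for [x^b] and 1 with exponents
    [b^-1] and [(1 - b)^-1]. *)
Lemma powR_le_affine b x : 0 < b -> b < 1 -> 0 <= x -> x `^ b <= b * x + (1 - b).
Proof.
move=> b0 b1 x0.
have := @conjugate_powR R (x `^ b) 1 b^-1 (1 - b)^-1.
rewrite powR_ge0 ler01 !invr_gt0 b0 subr_gt0 b1 !invrK addrC subrK powR1 mulr1 mul1r.
rewrite -powRrM divff ?gt_eqF// powRr1// => /(_ isT isT isT isT erefl).
by rewrite mulrC.
Qed.

(** Scaling moves the tangent from 1 to [y]. With [a = b + 1] and logarithms for [x] and [y],
    increments of [ln^a] dominate [a * ln^b j / j]. *)
Lemma powR_diff_ge a x y : 0 < a -> a < 1 -> 0 < y -> 0 <= x ->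
  a * (y `^ (a - 1) * (y - x)) <= y `^ a - x `^ a.
Proof.
move=> a0 a1 y0 x0.
have := powR_le_affine a0 a1 (divr_ge0 x0 (ltW y0)).
rewrite powRM// ?invr_ge0 ?(ltW y0)// => H.
have ya : 0 < y `^ a by rewrite powR_gt0.
have yv : (y^-1) `^ a = (y `^ a)^-1 by rewrite -powRN -powR_inv1 ?(ltW y0)// -powRrM mulN1r.
have -> : y `^ (a - 1) = y `^ a / y.
  by rewrite !powR_expR// mulrBl mul1r expRB lnK.
rewrite -(ler_pM2r ya) in H.
rewrite yv mulfVK ?gt_eqF// in H.
have -> : y `^ a / y * (y - x) = y `^ a - y `^ a * (x / y).
  by rewrite mulrBr mulfVK ?gt_eqF//; ring.
lra.
Qed.

End RegularVariation.

(** * Karamata estimates for the tail sums *)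

Section TailSums.
Context {R : realType}.
Variables (f : nat -> R) (b : R).
Hypothesis b_gt : -1 < b.
Hypothesis f_ge0 : forall r, 0 <= f r.
Hypothesis f_le1 : forall r, f r <= 1.
Hypothesis f_lim : forall e, 0 < e -> exists N, forall n, (N <= n)%N -> f n < e.
Hypothesis f_reg : exists r0 : nat, forall r : nat, (r0 <= r)%N ->
  f r = Num.min ((ln (r%:R : R)) `^ b / r%:R) 1.

(** For a tail function [f] this is the mean of the positive part of [min(R, n) - h]. *)
Definition tsum h n : R := \sum_(h.+1 <= j < n.+1) f j.

(** As [f] tends to 0, the minimum cannot be attained by 1 for large [n]. *)
Lemma tail_eq : exists N : nat, forall n, (N <= n)%N ->
  f n = (ln (n%:R : R)) `^ b / n%:R.
Proof.
have [r0 f0] := f_reg; have [N1 fN1] := f_lim ltr01.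
exists (maxn r0 N1) => n; rewrite geq_max => /andP[n0 n1].
have := fN1 n n1; rewrite f0// /Order.min; case: ifP => // _.
by rewrite ltxx.
Qed.

Lemma tail_le : exists2 K : R, 0 < K & forall n, (1 < n)%N ->
  f n <= K * ((ln (n%:R : R)) `^ b / n%:R).
Proof.
have [N fN] := tail_eq.
pose v n : R := (ln (n%:R : R)) `^ b / n%:R.
have v0 n : 0 <= v n by rewrite divr_ge0// powR_ge0.
have s0 : 0 <= \sum_(r < N) (v r)^-1 by apply: sumr_ge0 => i _; rewrite invr_ge0.
(* The sum absorbs the finitely many arguments below [N], where only [f <= 1] is used. *)
exists (1 + \sum_(r < N) (v r)^-1); first by lra.
move=> n n1; have [Nn|nN] := leqP N n.
  by rewrite fN// -/(v n) ler_peMl//; lra.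
have vn : 0 < v n.
  by rewrite divr_gt0 ?powR_gt0 ?ln_gt0 ?ltr1n// ltr0n; lia.
apply: le_trans (f_le1 n) _; rewrite -/(v n) -ler_pdivrMr// mul1r.
rewrite (bigD1 (Ordinal nN))//=.
have : 0 <= \sum_(i < N | i != Ordinal nN) (v i)^-1.
  by apply: sumr_ge0 => i _; rewrite invr_ge0.
by set u := (v n)^-1; lra.
Qed.

(** If [b >= 0], then [ln^b j <= ln^b n] and a harmonic sum remains. If [b < 0], this comparison is
    reversed, and one sums the increments of [ln^(b+1)] instead; the constant [1 / (b + 1)] appears
    there. *)
Lemma tsum_le_powR : exists2 C : R, 0 < C & forall n h, (4 <= n)%N -> (h < n)%N ->
  tsum h n <= C * (ln (n%:R : R)) `^ b * (1 + ln n%:R - ln h.+1%:R).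
Proof.
have [K K0 fK] := tail_le.
have [b0|b0] := leP 0 b.
  exists (K + 1); first lra.
  move=> n h n4 hn; have ln1 := @ln_nat_ge1 R n n4.
  have L1 : 1 <= ln (n%:R : R) `^ b.
    by rewrite -[leLHS](powRr0 (ln (n%:R : R))) ler_powR.
  apply: (@le_trans _ _ (\sum_(h.+1 <= j < n.+1) (K + 1) * ln (n%:R : R) `^ b * j%:R^-1)).
    rewrite /tsum !big_nat; apply: ler_sum => j /andP[hj jn].
    have [->|j1] := eqVneq j 1%N.
      by rewrite invr1 mulr1; apply: le_trans (f_le1 _) _; nra.
    have {}j1 : (1 < j)%N by lia.
    apply: le_trans (fK _ j1) _; rewrite mulrA ler_pM2r ?invr_gt0 ?ltr0n; last lia.
    have : ln (j%:R : R) `^ b <= ln (n%:R : R) `^ b.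
      rewrite ge0_ler_powR ?nnegrE ?ln_ge0 ?ler1n//; try lia.
      rewrite ler_ln ?posrE ?ltr0n ?ler_nat; lia.
    by nra.
  rewrite -mulr_sumr ler_wpM2l//; first by apply: mulr_ge0; [lra|exact: powR_ge0].
  by apply: sum_inv_le; lia.
(* For [b < 0], sum the increments of [ln^a], a concave function of [ln]. *)
pose a := b + 1; have a0 : 0 < a by rewrite /a -ltrBlDr sub0r.
have a1 : a < 1 by rewrite /a -ltrBrDr subrr.
have Ka : 0 < K / a by rewrite divr_gt0.
exists (1 + K / a); first lra.
have powa (n : nat) : (1 < n)%N -> ln (n%:R : R) `^ a = ln (n%:R : R) `^ b * ln n%:R.
  move=> n1; have l0 : 0 < ln (n%:R : R) by rewrite ln_gt0// ltr1n.
  by rewrite !powR_expR// /a mulrDl mul1r expRD lnK.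
have key n h : (4 <= n)%N -> (0 < h < n)%N ->
    tsum h n <= K / a * ln (n%:R : R) `^ b * (ln n%:R - ln h%:R).
  move=> n4 /andP[h0 hn].
  apply: (@le_trans _ _ (K / a * (ln (n%:R : R) `^ a - ln (h%:R : R) `^ a))).
    rewrite -(telescope_sumr (fun j => ln (j%:R : R) `^ a)); last lia.
    rewrite mulr_sumr /tsum big_add1/= !big_nat; apply: ler_sum => j /andP[hj jn].
    apply: le_trans (fK _ _) _; first lia.
    rewrite -mulrA ler_pM2l// (mulrC a^-1) ler_pdivlMr// [leLHS]mulrC.
    have l0 : 0 < ln (j.+1%:R : R) by rewrite ln_gt0// ltr1n; lia.
    have l1 : 0 <= ln (j%:R : R) by rewrite ln_ge0// ler1n; lia.
    have := powR_diff_ge a0 a1 l0 l1; apply: le_trans.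
    rewrite ler_pM2l// /a addrK ler_wpM2l ?powR_ge0//.
    by apply: (@inv_le_ln_diff R j.+1); lia.
  rewrite -[leRHS]mulrA ler_pM2l// powa; last lia.
  rewrite mulrBr lerB//.
  (* What remains is [ln^b n * ln h <= ln^a h], true because [ln^b] decreases; [h = 1] is apart
     since [ln 1 = 0]. *)
  have [->|h1] := eqVneq h 1%N; first by rewrite ln1 mulr0 powR_ge0.
  rewrite powa; last lia.
  have l1 : 0 < ln (h%:R : R) by rewrite ln_gt0// ltr1n; lia.
  rewrite ler_pM2r// !powR_expR//; last by rewrite ln_gt0// ltr1n; lia.
  rewrite ler_expR; apply: ler_wnM2l; first exact: ltW.
  have l2 : ln (h%:R : R) <= ln (n%:R : R).
    by rewrite ler_ln ?posrE ?ltr0n ?ler_nat; lia.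
  by rewrite ler_ln ?posrE// (lt_le_trans l1).
move=> n h n4 hn; have ln1n := @ln_nat_ge1 R n n4.
have Lb : 0 <= ln (n%:R : R) `^ b by exact: powR_ge0.
(* [key] telescopes from [ln h] with [h > 0]. For [h = 0] the extra term satisfies
   [f 1 <= 1 <= ln^a n], whence the [1] in [1 + K / a]. *)
have [h0|h0] := posnP h.
  rewrite h0 ln1 subr0 /tsum big_ltn; last lia.
  have := key n 1%N n4 ltac:(lia); rewrite ln1 subr0 -/(tsum 1 n) => k1.
  have : 1 <= ln (n%:R : R) `^ b * ln n%:R.
    rewrite -powa; last lia.
    by rewrite -[leLHS](powRr0 (ln (n%:R : R))) ler_powR// ltW.
  have := f_le1 1%N; move: k1 Ka; set u := K / a; nra.
apply: le_trans (key n h n4 _) _; first by rewrite h0.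
have := @ln_diff_le_inv R h h0.
have : h%:R^-1 <= 1 :> R by rewrite invf_le1 ?ltr0n// ler1n.
set v := (h%:R^-1 : R) => v1 v2.
have l3 : ln (h.+1%:R : R) <= ln (n%:R : R).
  by rewrite ler_ln ?posrE ?ltr0n ?ler_nat; lia.
have ? : ln (n%:R : R) - ln h%:R <= 1 + ln n%:R - ln h.+1%:R by lra.
have ? : 0 <= 1 + ln (n%:R : R) - ln h.+1%:R by lra.
apply: (@le_trans _ _ (K / a * ln (n%:R : R) `^ b * (1 + ln n%:R - ln h.+1%:R))).
  by apply: ler_wpM2l => //; apply: mulr_ge0 => //; exact: ltW.
by apply: ler_wpM2r => //; apply: ler_wpM2r => //; lra.
Qed.

Lemma tsum_le : exists2 C : R, 0 < C & exists N : nat,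
  forall n h, (N <= n)%N -> (h < n)%N ->
  tsum h n <= C * (n%:R * f n) * (1 + ln n%:R - ln h.+1%:R).
Proof.
have [C C0 tC] := tsum_le_powR; have [N fN] := tail_eq.
exists C => //; exists (maxn 4 N) => n h; rewrite geq_max => /andP[n4 nN] hn.
rewrite fN// (mulrC n%:R) divfK ?pnatr_eq0; [exact: tC|lia].
Qed.

(** Only the [j] above the integer square root [m] of [n] are kept. There [ln j] lies between
    [ln n / 2] and [ln n], so [ln^b j >= 2^(-|b|) * ln^b n] for either sign of [b], and the [j^-1]
    still sum to at least [ln n / 4]. *)
Lemma tsum_ge : exists2 c : R, 0 < c & exists N : nat,
  forall n, (N <= n)%N -> c * (n%:R * f n) * ln n%:R <= tsum 0 n.
Proof.
clear b_gt.
have [N fN] := tail_eq.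
have l2 : 0 < ln (2 : R) by rewrite ln_gt0// ltr1n.
pose c := expR (- (`|b| * ln 2)) : R; have c0 : 0 < c := expR_gt0 _.
exists (c / 4); first by rewrite divr_gt0.
exists (maxn 16 (N * N)) => n; rewrite geq_max => /andP[n16 nN].
have [m /andP[m1 m2]] : exists m, (m * m <= n < m.+1 * m.+1)%N.
  elim: n {n16 nN} => [|n [m /andP[m1 m2]]]; first by exists 0%N.
  have [?|?] := leqP (m.+1 * m.+1) n.+1; first by exists m.+1; nia.
  by exists m; nia.
have m4 : (3 <= m)%N by nia.
have mN : (N <= m.+1)%N by nia.
have n1 : 1 < n%:R :> R by rewrite ltr1n; lia.
have ln0n : 0 < ln (n%:R : R) by rewrite ln_gt0.
have lnj j : (m < j <= n)%N -> ln (n%:R : R) / 2 <= ln (j%:R : R) <= ln n%:R.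
  move=> /andP[mj jn]; rewrite !ler_ln ?posrE ?ltr0n ?ler_nat; [|lia|lia].
  rewrite jn andbT ler_pdivrMr// mulr_natr -lnXn ?ltr0n; last lia.
  by rewrite ler_ln ?posrE -?natrX ?ltr0n ?ler_nat ?expn_gt0//; nia.
have Lj j : (m < j <= n)%N -> c * ln (n%:R : R) `^ b <= ln (j%:R : R) `^ b.
  move=> hj; have /andP[h1 h2] := lnj j hj.
  have lj0 : 0 < ln (j%:R : R) by lra.
  rewrite !powR_expR// /c -expRD ler_expR.
  have h3 : ln (ln (j%:R : R)) <= ln (ln (n%:R : R)) by rewrite ler_ln.
  have h4 : ln (ln (n%:R : R)) - ln 2 <= ln (ln (j%:R : R)).
    by rewrite -ln_div ?posrE// ler_ln// posrE divr_gt0.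
  by have [?|?] := ger0P b; nra.
have hs : ln n%:R / 4 <= \sum_(m.+1 <= j < n.+1) (j%:R^-1 : R).
  apply: (@le_trans _ _ (ln n.+1%:R - ln m.+1%:R)).
    have : ln (n%:R : R) <= ln n.+1%:R by rewrite ler_ln ?posrE ?ltr0n ?ler_nat; lia.
    have : ln (m.+1%:R : R) *+ 2 <= ln 2 *+ 2 + ln n%:R.
      rewrite -!lnXn ?ltr0n// -lnM ?posrE ?exprn_gt0 ?ltr0n//; last lia.
      rewrite ler_ln ?posrE ?mulr_gt0 ?exprn_gt0 ?ltr0n//; last lia.
      rewrite -!natrX -natrM ler_nat; nia.
    have : ln 2 *+ 4 <= ln n%:R :> R.
      rewrite -lnXn// ler_ln ?posrE ?exprn_gt0 ?ltr0n//; last lia.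
      by rewrite -natrX ler_nat.
    lra.
  rewrite -(telescope_sumr (fun j => ln (j%:R : R))); last nia.
  rewrite !big_nat; apply: ler_sum => j /andP[mj _].
  by apply: ln_diff_le_inv; lia.
apply: (@le_trans _ _ (\sum_(m.+1 <= j < n.+1) f j)); last first.
  rewrite /tsum (@big_cat_nat _ _ _ m.+1 1)//=; last nia.
  by rewrite lerDr sumr_ge0.
apply: (@le_trans _ _ (\sum_(m.+1 <= j < n.+1) c * ln (n%:R : R) `^ b * j%:R^-1)).
  rewrite -mulr_sumr fN ?(mulrC n%:R) ?divfK ?pnatr_eq0; [|lia|nia].
  rewrite -[leLHS]mulrA (mulrC _ (ln _)) mulrA; move: hs.
  have : 0 <= ln (n%:R : R) `^ b by exact: powR_ge0.
  set u := ln _ `^ b; set s := \sum_(_ <= _ < _) _ => u0 su.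
  have cu : 0 <= c * u by rewrite mulr_ge0// ltW.
  have := ler_wpM2l cu su; lra.
rewrite !big_nat; apply: ler_sum => j hj.
rewrite fN; last lia.
by rewrite ler_wpM2r ?invr_ge0// Lj.
Qed.

(** Averages of a null sequence tend to 0. This keeps the probability of hitting a given point at
    most 1/2. *)
Lemma tsum_le_half : exists N : nat, forall n, (N <= n)%N -> tsum 0 n <= n%:R / 2.
Proof.
clear b_gt.
have [N fN] : exists N : nat, forall n, (N <= n)%N -> f n < 4^-1.
  by apply: f_lim; rewrite invr_gt0.
exists (4 * N.+1)%N => n nN.
rewrite /tsum (@big_cat_nat _ _ _ N.+1 1)//=; last lia.
have : \sum_(1 <= i < N.+1) f i <= N%:R.
  apply: (@le_trans _ _ (\sum_(1 <= i < N.+1) 1)); first exact: ler_sum.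
  by rewrite big_const_nat iter_addr addr0 subn1.
have : \sum_(N.+1 <= i < n.+1) f i <= 4^-1 * (n - N)%:R.
  apply: (@le_trans _ _ (\sum_(N.+1 <= i < n.+1) 4^-1)).
    by rewrite !big_nat; apply: ler_sum => i /andP[Ni _]; apply/ltW/fN; lia.
  by rewrite big_const_nat iter_addr addr0 subSS mulr_natr.
have : (4 * N)%:R <= n%:R :> R by rewrite ler_nat; lia.
have : (n - N)%:R <= n%:R :> R by rewrite ler_nat; lia.
rewrite natrM; lra.
Qed.

Lemma sum_inv_sqrt_le n :
  \sum_(h < n) (Num.sqrt (h.+1%:R : R))^-1 <= 2 * Num.sqrt n%:R.
Proof.
elim: n => [|n IHn]; first by rewrite big_ord0 sqrtr0 mulr0.
rewrite big_ord_recr/=; set s := Num.sqrt n%:R in IHn *.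
set t := Num.sqrt (n.+1%:R : R).
have t0 : 0 < t by rewrite sqrtr_gt0.
have s0 : 0 <= s by rewrite sqrtr_ge0.
have ts : t ^+ 2 = s ^+ 2 + 1 by rewrite !sqr_sqrtr// -natr1.
have : t^-1 <= 2 * t - 2 * s.
  rewrite -[leLHS]mul1r ler_pdivrMr//; nra.
by set u := t^-1; lra.
Qed.

Lemma sum_exp_tsum : exists2 s : R, 0 < s & exists N : nat,
  forall n k, (N <= n)%N -> k%:R * f n <= s ->
  \sum_(h < n) expR (8 * k%:R / n%:R * tsum h n) <= 2 * expR 2^-1 * n%:R.
Proof.
have [C C0 [N tN]] := tsum_le.
(* Chosen so that [8 * C * k * f n <= 2^-1]: each exponential is then at most
   [expR 2^-1 * sqrt (n / (h + 1))], and the inverse square roots sum to at most [2 * sqrt n]. *)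
exists (16 * C)^-1; first by rewrite invr_gt0 mulr_gt0.
exists N.+1 => n k nN ks; have n0 : 0 < n%:R :> R by rewrite ltr0n; lia.
apply: (@le_trans _ _ (\sum_(h < n) expR 2^-1 * Num.sqrt n%:R * (Num.sqrt (h.+1%:R : R))^-1)).
  apply: ler_sum => h _.
  have sq (m : nat) : (0 < m)%N -> Num.sqrt (m%:R : R) = expR (2^-1 * ln m%:R).
    by move=> m0; rewrite -powR12_sqrt// powR_expR// ltr0n.
  rewrite !sq//; last by lia.
  rewrite -expRN -!expRD ler_expR.
  have t1 := tN n h (ltnW nN) (ltn_ord h).
  have hn := ltn_ord h.
  have l1 : ln (h.+1%:R : R) <= ln n%:R by rewrite ler_ln ?posrE ?ltr0n ?ler_nat; lia.
  apply: (@le_trans _ _ (8 * k%:R / n%:R * (C * (n%:R * f n) * (1 + ln n%:R - ln h.+1%:R)))).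
    by rewrite ler_wpM2l// divr_ge0// mulr_ge0.
  have -> : 8 * k%:R / n%:R * (C * (n%:R * f n) * (1 + ln n%:R - ln h.+1%:R)) =
    8 * C * (k%:R * f n) * (1 + ln n%:R - ln h.+1%:R).
    by field; rewrite gt_eqF.
  have ks' : 8 * C * (k%:R * f n) <= 2^-1.
    apply: le_trans (ler_wpM2l _ ks) _; first by rewrite mulr_ge0// ltW.
    by rewrite le_eqVlt; apply/orP; left; apply/eqP; field; rewrite gt_eqF.
  apply: le_trans (ler_wpM2r _ ks') _; first lra.
  lra.
rewrite -mulr_sumr; have := sum_inv_sqrt_le n.
have sn : Num.sqrt (n%:R : R) * Num.sqrt n%:R = n%:R by rewrite -expr2 sqr_sqrtr.
have e0 := expR_gt0 (2^-1 : R); have s0 := sqrtr_ge0 (n%:R : R).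
set S := \sum_(_ < _) _ => hS.
rewrite -[leRHS]mulrA mulrCA -{2}sn -!mulrA ler_pM2l//; nra.
Qed.

End TailSums.

(** * Real-valued probabilities and independence *)

Section RealProbability.
Context {R : realType} {d : measure_display} {Omega : measurableType d}.
Variable P : probability Omega R.
Implicit Types A B : set Omega.

Definition pr A : R := fine (P A).

Lemma prE A : measurable A -> P A = (pr A)%:E.
Proof. by move=> mA; rewrite /pr fineK// fin_num_measure. Qed.

Lemma pr_ge0 A : 0 <= pr A.
Proof. exact: fine_ge0. Qed.

Lemma pr_le1 A : measurable A -> pr A <= 1.
Proof. by move=> mA; rewrite -lee_fin -prE// probability_le1. Qed.

Lemma pr_le A B : measurable A -> measurable B -> A `<=` B -> pr A <= pr B.
Proof.
by move=> mA mB AB; rewrite -lee_fin -!prE// le_measure// inE.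
Qed.

Lemma prU2 A B : measurable A -> measurable B -> pr (A `|` B) <= pr A + pr B.
Proof.
move=> mA mB; rewrite -lee_fin EFinD -!prE//; last exact: measurableU.
exact: measureU2.
Qed.

Lemma prC A : measurable A -> pr (~` A) = 1 - pr A.
Proof.
move=> mA; apply: EFin_inj; rewrite EFinB -!prE//; last exact: measurableC.
exact: probability_setC.
Qed.

Lemma setU_finType (T : finType) (S : pred T) (F : T -> set Omega) :
  [set w | exists2 x, S x & F x w] = \big[setU/set0]_(x in S) F x.
Proof.
rewrite -bigcup_seq_cond; apply/seteqP; split=> w /=.
  by case=> x Sx Fx; exists x => //=; rewrite mem_index_enum.
by case=> x /= /andP[_ Sx] Fx; exists x.
Qed.

Lemma measurable_finType (T : finType) (S : pred T) (F : T -> set Omega) :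
  (forall x, measurable (F x)) -> measurable [set w | exists2 x, S x & F x w].
Proof. by move=> mF; rewrite setU_finType; apply: bigsetU_measurable. Qed.

Lemma pr_finType_le (T : finType) (S : pred T) (F : T -> set Omega) :
  (forall x, measurable (F x)) ->
  pr [set w | exists2 x, S x & F x w] <= \sum_(x | S x) pr (F x).
Proof.
move=> mF; rewrite setU_finType.
suff [] : measurable (\big[setU/set0]_(x in S) F x) /\
  pr (\big[setU/set0]_(x in S) F x) <= \sum_(x | S x) pr (F x) by [].
apply: (big_rec2 (fun A (r : R) => measurable A /\ pr A <= r)).
  by split=> //; rewrite /pr measure0.
move=> x r A _ [mA Ar]; split; first exact: measurableU.
by rewrite (le_trans (prU2 _ _))// lerD2l.
Qed.

Lemma pr_finType (T : finType) (S : pred T) (X : Omega -> T) :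
  (forall x, measurable (X @^-1` [set x])) ->
  pr [set w | S (X w)] = \sum_(x | S x) pr (X @^-1` [set x]).
Proof.
move=> mX.
have -> : [set w | S (X w)] = \bigcup_(x in [set` S]) (X @^-1` [set x]).
  apply/seteqP; split=> w /=; first by move=> SX; exists (X w).
  by case=> x /= Sx Xx; rewrite Xx.
rewrite {1}/pr measure_fin_bigcup//; last first.
  by move=> x y _ _ [w [/= Xx Xy]]; rewrite -Xx -Xy.
rewrite fsbig_finite//=.
under eq_bigr do rewrite prE//.
rewrite sumEFin/=.
rewrite -[RHS]big_filter/=.
apply: perm_big; apply: uniq_perm.
- exact: finmap.fset_uniq.
- by rewrite filter_uniq// index_enum_uniq.
- by move=> x; rewrite in_fset_set// mem_filter mem_index_enum andbT mem_setE.
Qed.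

Lemma measurable_preimage_pred (T : finType) (S : pred T) (X : Omega -> T) :
  (forall x, measurable (X @^-1` [set x])) -> measurable [set w | S (X w)].
Proof.
move=> mX; have -> : [set w | S (X w)] = [set w | exists2 x, S x & X w = x].
  by apply/seteqP; split=> w /=; [exists (X w)|case=> x Sx Xx; rewrite Xx].
exact: (@measurable_finType _ _ (fun x => X @^-1` [set x])).
Qed.

End RealProbability.

Section Independence.
Context {R : realType} {d : measure_display} {Omega : measurableType d}.
Variables (P : probability Omega R) (n : nat).
Variables (Rv U : nat -> Omega -> nat) (E : nat -> Omega -> R).
Hypothesis M : covering_model P n Rv U E.

Lemma meas_Rv i (A : set nat) : measurable (Rv i @^-1` A).
Proof. by have [_ [+ _ _ _ _]] := M => /(_ i A)[]. Qed.

Lemma meas_U i (A : set nat) : measurable (U i @^-1` A).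
Proof.
have [_ [_ Un mU _ _]] := M.
have -> : U i @^-1` A = [set w | exists2 u : 'I_n, u \in [pred u : 'I_n | `[< A u >] ] & U i w = u].
  apply/seteqP; split=> w /= => [AU|[u]].
    by exists (Ordinal (Un i w)) => //; rewrite inE.
  by rewrite inE => Au ->.
have := @measurable_finType _ _ 'I_n [pred u : 'I_n | `[< A u >] ] (fun u : 'I_n => U i @^-1` [set val u]).
by apply=> u; case: (mU i u).
Qed.

Lemma meas_E i (A : set R) : measurable A -> measurable (E i @^-1` A).
Proof.
have [_ [_ _ _ mE _]] := M => mA; rewrite -[X in measurable X]setTI.
by have [+ _] := mE i; apply.
Qed.

Lemma pr_E_gt i (x : R) : 0 <= x -> pr P [set w | x < E i w] = expR (- x).
Proof. by have [_ [_ _ _ mE _]] := M => x0; rewrite /pr (proj2 (mE i) x x0). Qed.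

Lemma pr_U i u : (u < n)%N -> pr P (U i @^-1` [set u]) = n%:R^-1.
Proof. by have [_ [_ _ mU _ _]] := M => un; rewrite /pr (proj2 (mU i u un)). Qed.

Lemma pr_Rv i A : pr P (Rv i @^-1` A) = pr P (Rv 0%N @^-1` A).
Proof. by have [_ [mR _ _ _ _]] := M; rewrite /pr (proj2 (mR i A)). Qed.

Lemma indep_prod (J : seq idx) (A : idx -> set Omega) : uniq J ->
  (forall i, i \in J -> gen_events Rv U E i (A i)) ->
  (forall i, i \in J -> measurable (A i)) ->
  pr P (\big[setI/setT]_(i <- J) A i) = \prod_(i <- J) pr P (A i).
Proof.
have [_ [_ _ _ _ indep]] := M => uJ gJ mJ.
rewrite {1}/pr indep// (eq_big_seq (fun i => (pr P (A i))%:E)); last first.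
  by move=> i iJ; rewrite prE//; exact: mJ.
by rewrite prodEFin.
Qed.

Lemma pr_indep_E k (A : 'I_k -> set R) : (forall i, measurable (A i)) ->
  measurable [set w | forall i, A i (E i w)] /\
  pr P [set w | forall i, A i (E i w)] = \prod_(i < k) pr P (E i @^-1` A i).
Proof.
move=> mA.
(* Independence is stated for families over all of [idx]; indices outside the first [k] interarrival
   times get the sure event. *)
pose F (j : idx) : set Omega := match j with
  | inr (inr m) => if insub m is Some i then E m @^-1` A i else setT
  | _ => setT end.
have eqF (i : 'I_k) : F (inr (inr (i : nat))) = E i @^-1` A i.
  by rewrite /F (valK i).
clearbody F.
pose J : seq idx := [seq inr (inr (nat_of_ord i)) | i <- enum 'I_k].
have mF j : j \in J -> measurable (F j).
  by case/mapP => i _ ->; rewrite eqF; exact: meas_E.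
have -> : [set w | forall i, A i (E i w)] = \big[setI/setT]_(j <- J) F j.
  rewrite -bigcap_seq; apply/seteqP; split=> w /= H.
    by move=> j /mapP[i _ ->]; rewrite eqF; exact: H.
  move=> i; have := H (inr (inr (i : nat))); rewrite eqF; apply.
  by rewrite /= map_f ?mem_enum.
split.
  by rewrite big_seq; apply: (big_ind measurable) => // *; exact: measurableI.
rewrite indep_prod//.
- by rewrite big_map big_enum/=; apply: eq_bigr => i _; rewrite eqF.
- by rewrite map_inj_uniq ?enum_uniq// => i j [] /val_inj.
- by move=> j /mapP[i _ ->]; rewrite eqF/=; exists (A i) => //=; exact: mA.
Qed.

Lemma pr_indep_RU k (A B : 'I_k -> set nat) :
  measurable [set w | forall i : 'I_k, A i (Rv i w) /\ B i (U i w)] /\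
  pr P [set w | forall i : 'I_k, A i (Rv i w) /\ B i (U i w)] =
    \prod_(i < k) (pr P (Rv i @^-1` A i) * pr P (U i @^-1` B i)).
Proof.
pose F (j : idx) : set Omega := match j with
  | inl m => if insub m is Some i then Rv m @^-1` A i else setT
  | inr (inl m) => if insub m is Some i then U m @^-1` B i else setT
  | _ => setT end.
have eqR (i : 'I_k) : F (inl (i : nat)) = Rv i @^-1` A i by rewrite /F (valK i).
have eqU (i : 'I_k) : F (inr (inl (i : nat))) = U i @^-1` B i by rewrite /F (valK i).
clearbody F.
pose J : seq idx := [seq inl (nat_of_ord i) | i <- enum 'I_k] ++
  [seq inr (inl (nat_of_ord i)) | i <- enum 'I_k].
have JP j : j \in J -> exists i : 'I_k, j = inl (i : nat) \/ j = inr (inl (i : nat)).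
  by rewrite mem_cat => /orP[] /mapP[i _ ->]; exists i; [left|right].
have mF j : j \in J -> measurable (F j).
  by case/JP => i [] ->; rewrite ?eqR ?eqU; [exact: meas_Rv|exact: meas_U].
have -> : [set w | forall i : 'I_k, A i (Rv i w) /\ B i (U i w)] =
    \big[setI/setT]_(j <- J) F j.
  rewrite -bigcap_seq; apply/seteqP; split=> w /= H.
    by move=> j /JP[i [] ->]; rewrite ?eqR ?eqU; have [] := H i.
  move=> i; split.
    have := H (inl (i : nat)); rewrite eqR; apply.
    by rewrite /= mem_cat map_f ?mem_enum.
  have := H (inr (inl (i : nat))); rewrite eqU; apply.
  by rewrite /= mem_cat orbC map_f ?mem_enum.
split.
  by rewrite big_seq; apply: (big_ind measurable) => // *; exact: measurableI.
rewrite indep_prod//.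
- rewrite big_cat/= big_map big_enum/= [X in _ * X]big_map big_enum/= -big_split/=.
  by apply: eq_bigr => i _; rewrite eqU eqR.
- have injR : injective (fun i : 'I_k => inl (nat_of_ord i) : idx) by move=> i j [] /val_inj.
  have injU : injective (fun i : 'I_k => inr (inl (nat_of_ord i)) : idx) by move=> i j [] /val_inj.
  rewrite /J cat_uniq (map_inj_uniq injR) (map_inj_uniq injU) enum_uniq andbT/=.
  by apply/hasPn => x /mapP[i _ ->] /=; apply/negP => /mapP[i' _].
- by move=> j /JP[i [] ->]; rewrite ?eqR ?eqU/=; [exists (A i)|exists (B i)].
Qed.

End Independence.

Lemma card_ord_itv n a r : (r <= n)%N ->
  #|[pred j : 'I_n | (a <= j < r)%N]| = (r - a)%N.
Proof.
move=> rn; rewrite -sum1_card.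
rewrite (eq_bigl (fun j : 'I_n => (a <= j)%N && (j < r)%N)); last first.
  by move=> j; rewrite inE.
rewrite -(big_ord_widen_cond n (fun j => (a <= j)%N) (fun _ => 1%N) rn).
by rewrite -(big_geq_mkord a r xpredT (fun _ => 1%N)) sum_nat_const_nat muln1.
Qed.

(** * Covering as a finite model: first and second moments *)

Section FiniteModel.
Context {R : realType} {d : measure_display} {Omega : measurableType d}.
Variables (P : probability Omega R) (N : nat).
Variables (Rv U : nat -> Omega -> nat) (E : nat -> Omega -> R).
Hypothesis M : covering_model P N.+1 Rv U E.
Notation n := N.+1.

(* An object enters the covering of Z/n only through its starting point and its
   radius truncated at n, so k objects take finitely many values. *)
Notation obj := ('I_n * 'I_n.+1)%type.

Definition obs k (w : Omega) : {ffun 'I_k -> obj} :=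
  [ffun i : 'I_k => (inord (U i w), inord (minn (Rv i w) n))].

Definition rho (r : 'I_n.+1) : R := pr P [set w | minn (Rv 0%N w) n = r].

Definition wt (v : obj) : R := n%:R^-1 * rho v.2.

(* [x - v.1] is taken in Z/n: the distance from the start of the object to [x]. *)
Definition hits (x : 'I_n) (v : obj) := (val (x - v.1)%R < v.2)%N.

Lemma wt_ge0 v : 0 <= wt v.
Proof. by rewrite mulr_ge0 ?invr_ge0 ?pr_ge0. Qed.

Lemma obs_law k (g : {ffun 'I_k -> obj}) :
  measurable (obs k @^-1` [set g]) /\
  pr P (obs k @^-1` [set g]) = \prod_i wt (g i).
Proof.
have [_ [_ Un _ _ _]] := M.
pose A (i : 'I_k) := [set r | minn r n = (g i).2].
pose B (i : 'I_k) := [set u | u = val (g i).1].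
have -> : obs k @^-1` [set g] = [set w | forall i : 'I_k, A i (Rv i w) /\ B i (U i w)].
  apply/seteqP; split=> w /=.
    by move=> gE i; rewrite /A /B /= -gE ffunE/= !inordK// ltnS geq_minr.
  move=> H; apply/ffunP => i; rewrite ffunE; have [/= -> ->] := H i.
  by rewrite !inord_val; case: (g i).
have [mS ->] := pr_indep_RU M A B; split=> //.
apply: eq_bigr => i _; rewrite (pr_Rv M) mulrC /wt; congr (_ * _).
exact: (@pr_U _ _ _ _ _ _ _ _ M i (val (g i).1) (ltn_ord _)).
Qed.

Lemma measurable_obs k (S : pred {ffun 'I_k -> obj}) :
  measurable [set w | S (obs k w)].
Proof. by apply: measurable_preimage_pred => g; have [] := obs_law g. Qed.

Lemma pr_obs k (S : pred {ffun 'I_k -> obj}) :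
  pr P [set w | S (obs k w)] = \sum_(g | S g) \prod_i wt (g i).
Proof.
rewrite pr_finType => [|g]; last by have [] := obs_law g.
by apply: eq_bigr => g _; have [] := obs_law g.
Qed.

Lemma sum_wt_all k (B : pred obj) :
  \sum_(g : {ffun 'I_k -> obj} | [forall i, B (g i)]) \prod_i wt (g i) =
  (\sum_(v | B v) wt v) ^+ k.
Proof.
rewrite -[in RHS](card_ord k) -prodr_const.
rewrite (bigA_distr_big _ (fun (_ : 'I_k) v => wt v)).
by apply: eq_bigl => g; apply/forallP/ffun_onP.
Qed.

Lemma sum_wt : \sum_v wt v = 1.
Proof.
have := sum_wt_all 1 xpredT; rewrite expr1 => <-.
rewrite -pr_obs (_ : [set w | _] = setT) /pr ?probability_setT//.
by apply/seteqP; split=> w //= _; apply/forallP.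
Qed.

(** Truncation at [n] loses nothing: a point hit by an object is hit at an offset that is a residue,
    hence below [n]. *)
Lemma coveredE k w : covered n Rv U w k <->
  [forall x, [exists i, hits x (obs k w i)]].
Proof.
have [_ [_ Un _ _ _]] := M.
have hitE (x : 'I_n) (i : 'I_k) : hits x (obs k w i) <->
    exists2 j, (j < Rv i w)%N & val x = ((U i w + j) %% n)%N.
  rewrite /hits ffunE /= !inordK ?ltnS ?geq_minr//; last exact: Un i w.
  have Ui := Un i w; have xn := ltn_ord x.
  rewrite leq_min; split.
    move=> /andP[H _]; exists ((x + (n - U i w) %% n) %% n)%N => //.
    rewrite modnDmr addnA modnDmr (_ : U i w + x + (n - U i w) = x + n)%N; last lia.
    by rewrite modnDr modn_small.
  case=> j jR xj; rewrite ltn_mod andbT xj modnDmr modnDml.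
  rewrite (_ : U i w + j + (n - U i w) = j + n)%N; last lia.
  by rewrite modnDr; apply: leq_ltn_trans (leq_mod _ _) jR.
split.
  move=> H; apply/forallP => x; have [i ik Hi] := H x (ltn_ord x).
  by apply/existsP; exists (Ordinal ik); apply/hitE.
move=> /forallP H x xn; have /existsP[i /hitE Hi] := H (Ordinal xn).
by exists i.
Qed.

Lemma measurable_covered k : measurable [set w | covered n Rv U w k].
Proof.
have -> : [set w | covered n Rv U w k] =
    [set w | [pred g : {ffun 'I_k -> obj} | [forall x, [exists i, hits x (g i)]]] (obs k w)].
  by apply/seteqP; split=> w /coveredE.
exact: measurable_obs.
Qed.

Lemma sum_rho j : (j <= n)%N -> \sum_(r : 'I_n.+1 | (j <= r)%N) rho r = tailR P Rv j.
Proof.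
move=> jn; pose X w : 'I_n.+1 := inord (minn (Rv 0%N w) n).
have XE (r : 'I_n.+1) : X @^-1` [set r] = [set w | minn (Rv 0%N w) n = r].
  apply/seteqP; split=> w /=; rewrite /X.
    by move=> Xr; rewrite -Xr inordK// ltnS geq_minr.
  by move=> ->; rewrite inord_val.
rewrite /tailR -/(pr P _).
have -> : [set w | (j <= Rv 0%N w)%N] = [set w | [pred r : 'I_n.+1 | (j <= r)%N] (X w)].
  by apply/seteqP; split=> w /=; rewrite /X inordK ?ltnS ?geq_minr// leq_min jn andbT.
rewrite pr_finType; first by apply: eq_bigr => r _; rewrite XE.
by move=> r; rewrite XE; exact: (meas_Rv M 0 [set m | minn m n = r]).
Qed.

(** Layer-cake formula: the truncated difference [r - h] counts the [j] with [h < j <= r]. *)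
Lemma sum_rho_sub h :
  \sum_r rho r * (r - h)%:R = tsum (tailR P Rv) h n.
Proof.
have cnt (r : 'I_n.+1) : (r - h)%:R = \sum_(h.+1 <= j < n.+1) (j <= r)%N%:R :> R.
  rewrite -natr_sum; congr (_%:R).
  have rn : (r.+1 <= n.+1)%N := ltn_ord r.
  rewrite -subSS -[LHS]muln1 -sum_nat_const_nat.
  rewrite (big_nat_widen _ _ _ xpredT (fun _ => 1%N) rn) big_mkcond/=.
  by apply: eq_bigr => j _; rewrite ltnS; case: leqP.
under eq_bigr do rewrite cnt mulr_sumr.
rewrite exchange_big/= /tsum !big_nat; apply: eq_bigr => j /andP[_ jn].
rewrite -sum_rho// [RHS]big_mkcond/=; apply: eq_bigr => r _.
by case: ifP; rewrite ?mulr1 ?mulr0.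
Qed.

(** The offset [x - v.1] of a fixed point is uniform because the start is, so only the number of
    admissible offsets matters. *)
Lemma sum_wt_start (B : 'I_n -> 'I_n.+1 -> bool) (x : 'I_n) :
  \sum_(v | B (x - v.1) v.2) wt v = n%:R^-1 * \sum_r rho r * #|[pred j | B j r]|%:R.
Proof.
rewrite mulr_sumr big_mkcond/=.
rewrite -(pair_bigA _ (fun u r => if B (x - u) r then wt (u, r) else 0))/=.
rewrite exchange_big/=; apply: eq_bigr => r _.
rewrite -big_mkcond/= (reindex_inj (inv_inj (subKr x)))/=.
under eq_bigl do rewrite subKr.
rewrite mulrA mulr_natr -sumr_const; apply: eq_bigl => j.
by rewrite inE.
Qed.

(** The probability that one object hits a given point, the same for all points. *)
Definition phit : R := tsum (tailR P Rv) 0 n / n%:R.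

Lemma sum_hits x : \sum_(v | hits x v) wt v = phit.
Proof.
rewrite (sum_wt_start (fun j r => j < r)%N x) mulrC /phit -sum_rho_sub.
congr (_ / _); apply: eq_bigr => r _; congr (_ * _%:R).
have rn : (r <= n)%N := ltn_ord r.
by rewrite -(card_ord_itv 0 rn); apply: eq_card => j; rewrite !inE.
Qed.

(** Let [h = y - x] and let [j] be the offset of [x], so that [y] has offset [h + j] modulo [n].
    Without wrapping, [j < r - h]; with wrapping, [n - h <= j < r], where [n - h] is [x - y]. Each
    alternative contributes one tail sum. *)
Lemma sum_hits2 x y : \sum_(v | hits x v && hits y v) wt v <=
  (tsum (tailR P Rv) (val (y - x)) n + tsum (tailR P Rv) (val (x - y)) n) / n%:R.
Proof.
pose B (j : 'I_n) (r : 'I_n.+1) := (j < r)%N && (val (y - x + j)%R < r)%N.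
rewrite (eq_bigl (fun v => B (x - v.1) v.2)); last first.
  by move=> v; rewrite /hits /B addrA subrK.
rewrite sum_wt_start mulrC ler_pM2r ?invr_gt0 ?ltr0n//.
rewrite -!sum_rho_sub -big_split/=; apply: ler_sum => r _.
rewrite -mulrDr ler_wpM2l ?pr_ge0// -natrD ler_nat.
have rn : (r <= n)%N := ltn_ord r.
have xy : val (x - y) = ((n - val (y - x)%R) %% n)%N by rewrite -opprB.
pose A := [pred j : 'I_n | (0 <= j < r - val (y - x)%R)%N].
pose A' := [pred j : 'I_n | (val (x - y)%R <= j < r)%N].
have -> : (r - val (y - x)%R)%N = #|A| by rewrite card_ord_itv ?subn0//; lia.
have -> : (r - val (x - y)%R)%N = #|A'| by rewrite card_ord_itv.
apply: (@leq_trans #|[predU A & A']|); last by rewrite -cardUI leq_addr.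
have hjE (j : 'I_n) : val (y - x + j) = ((val (y - x)%R + j) %% n)%N by [].
have hn := ltn_ord (y - x)%R.
have inA (j : 'I_n) : (j \in A) = (j < r - val (y - x)%R)%N by [].
have inA' (j : 'I_n) : (j \in A') = (((n - val (y - x)%R) %% n <= j)%N && (j < r)%N).
  by rewrite -xy.
apply/subset_leq_card/fintype.subsetP => j.
rewrite inE /B hjE => /andP[jr]; rewrite [_ \in _]inE.
have -> : (j \in A) || (j \in A') = (j < r - val (y - x)%R)%N ||
    (((n - val (y - x)%R) %% n <= j)%N && (j < r)%N) by rewrite inA inA'.
move: hn; set h := val (y - x)%R => hn; have jn := ltn_ord j.
have [hj|hj] := ltnP (h + j) n.
  by rewrite modn_small// => hjr; apply/orP; left; lia.
move=> _; apply/orP; right; rewrite jr andbT.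
by apply: leq_trans (leq_mod _ _) _; lia.
Qed.

Lemma sum_miss x : \sum_(v | ~~ hits x v) wt v = 1 - phit.
Proof. by rewrite -sum_wt (bigID (hits x) predT)/= sum_hits addrAC subrr add0r. Qed.

Lemma sum_miss2 x y : \sum_(v | ~~ hits x v && ~~ hits y v) wt v =
  1 - phit *+ 2 + \sum_(v | hits x v && hits y v) wt v.
Proof.
have := sum_wt; rewrite (bigID (hits x) predT)/= (bigID (hits y) (hits x))/=.
rewrite (bigID (hits y) (fun v => ~~ hits x v))/=.
have := sum_hits x; rewrite (bigID (hits y) (hits x))/=.
have := sum_hits y; rewrite (bigID (hits x) (hits y))/=.
under eq_bigl do rewrite andbC.
under [X in _ + X = _ -> _]eq_bigl do rewrite andbC.
set a := \sum_(_ | _) _; set b := \sum_(_ | _) _; set c := \sum_(_ | _) _.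
set e := \sum_(_ | _) _ => h1 h2 h3.
by rewrite mulr2n; lra.
Qed.


Definition prod_wt k (g : {ffun 'I_k -> obj}) : R := \prod_i wt (g i).

Definition missed k (g : {ffun 'I_k -> obj}) (x : 'I_n) : bool :=
  [forall i, ~~ hits x (g i)].

Definition nmissed k (g : {ffun 'I_k -> obj}) : R := \sum_x (missed g x)%:R.

Lemma prod_wt_ge0 k (g : {ffun 'I_k -> obj}) : 0 <= prod_wt g.
Proof. by apply: prodr_ge0 => i _; exact: wt_ge0. Qed.

Lemma nmissed_ge1 k (g : {ffun 'I_k -> obj}) x : missed g x -> 1 <= nmissed g.
Proof.
by move=> gx; rewrite /nmissed (bigD1 x)//= gx lerDl sumr_ge0.
Qed.

Lemma pr_uncovered k : pr P [set w | ~ covered n Rv U w k] =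
  \sum_(g : {ffun 'I_k -> obj} | [exists x, missed g x]) prod_wt g.
Proof.
rewrite -pr_obs; congr (pr P _); apply/seteqP; split=> w /=.
  move=> ncov; apply: contrapT => /negP; rewrite negb_exists => /forallP H.
  apply/ncov/coveredE/forallP => x; have := H x.
  by rewrite negb_forall => /existsP[i]; rewrite negbK => hi; apply/existsP; exists i.
move=> /existsP[x /forallP H] /coveredE/forallP/(_ x)/existsP[i hi].
by have := H i; rewrite hi.
Qed.

Lemma pr_uncovered_le k (B : pred obj) :
  (forall g : {ffun 'I_k -> obj}, [exists x, missed g x] -> [forall i, B (g i)]) ->
  pr P [set w | ~ covered n Rv U w k] <= (\sum_(v | B v) wt v) ^+ k.
Proof.
move=> H; rewrite pr_uncovered -sum_wt_all [leLHS]big_mkcond [leRHS]big_mkcond/=.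
apply: ler_sum => g _; have := H g; case: ifP => [_ -> //|_ _].
by case: ifP => // _; exact: prod_wt_ge0.
Qed.

Lemma pr_uncovered_large k : pr P [set w | ~ covered n Rv U w k] <=
  (1 - tailR P Rv n) ^+ k.
Proof.
have large : \sum_(v : obj | (n <= v.2)%N) wt v = tailR P Rv n.
  rewrite (sum_wt_start (fun _ r => (n <= r)%N) ord0).
  rewrite -(sum_rho (leqnn n)) [RHS]big_mkcond mulr_sumr.
  apply: eq_bigr => r _; case: ifP => nr.
    rewrite (eq_card (B := predT)); last by move=> j; rewrite !inE.
    by rewrite card_ord mulrC mulfK// pnatr_eq0.
  by rewrite eq_card0 ?mulr0// => j; rewrite !inE nr.
have -> : 1 - tailR P Rv n = \sum_(v : obj | ~~ (n <= v.2)%N) wt v.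
  by rewrite -sum_wt (bigID (fun v : obj => (n <= v.2)%N))/= large addrAC subrr add0r.
apply: (@pr_uncovered_le k (fun v => ~~ (n <= v.2)%N)) => g /existsP[x /forallP H].
apply/forallP => i; have := H i; rewrite /hits; apply: contraNN.
by apply: leq_trans; exact: ltn_ord.
Qed.

Lemma sum_nmissed k : \sum_(g : {ffun 'I_k -> obj}) prod_wt g * nmissed g =
  n%:R * (1 - phit) ^+ k.
Proof.
under eq_bigr do rewrite mulr_sumr.
rewrite exchange_big/= (eq_bigr (fun _ => (1 - phit) ^+ k)).
  by rewrite sumr_const card_ord mulr_natl.
move=> x _; rewrite -(sum_miss x) -sum_wt_all big_mkcond [RHS]big_mkcond/=.
by apply: eq_bigr => g _; rewrite /missed; case: ifP; rewrite ?mulr1 ?mulr0.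
Qed.

Lemma sum_nmissed2 k : \sum_(g : {ffun 'I_k -> obj}) prod_wt g * nmissed g ^+ 2 =
  \sum_x \sum_y (\sum_(v | ~~ hits x v && ~~ hits y v) wt v) ^+ k.
Proof.
under eq_bigr => g _.
  rewrite expr2 /nmissed big_distrlr/= mulr_sumr.
  under eq_bigr do rewrite mulr_sumr.
  over.
rewrite exchange_big/=; apply: eq_bigr => x _.
rewrite exchange_big/=; apply: eq_bigr => y _.
rewrite -sum_wt_all [RHS]big_mkcond/=; apply: eq_bigr => g _.
rewrite -natrM mulnb (_ : missed g x && missed g y = [forall i, ~~ hits x (g i) && ~~ hits y (g i)]).
  by case: ifP; rewrite ?mulr1 ?mulr0.
apply/andP/forallP => [[/forallP hx /forallP hy] i|H]; first by rewrite hx hy.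
by split; apply/forallP => i; have /andP[] := H i.
Qed.

(** Markov's inequality for the number of missed points. *)
Lemma pr_uncovered_first k : pr P [set w | ~ covered n Rv U w k] <=
  n%:R * (1 - phit) ^+ k.
Proof.
rewrite pr_uncovered -sum_nmissed big_mkcond/=; apply: ler_sum => g _.
case: ifP => [/existsP[x /nmissed_ge1 Z1]|_].
  by rewrite ler_peMr ?prod_wt_ge0.
by rewrite mulr_ge0 ?prod_wt_ge0// sumr_ge0.
Qed.

(* Paley-Zygmund: [1_{Z > 0} >= 2 l Z - l^2 Z^2] for every [l]. *)
Lemma pr_uncovered_second k (C : R) : 0 < C -> phit < 1 ->
  \sum_x \sum_y (\sum_(v | ~~ hits x v && ~~ hits y v) wt v) ^+ k <=
    C * (n%:R * (1 - phit) ^+ k) ^+ 2 ->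
  C^-1 <= pr P [set w | ~ covered n Rv U w k].
Proof.
move=> C0 p1; rewrite -sum_nmissed2 -sum_nmissed.
set m1 := \sum_g _ * nmissed g; set m2 := \sum_g _ => m2C.
have m1_gt0 : 0 < m1.
  by rewrite /m1 sum_nmissed mulr_gt0 ?ltr0n// exprn_gt0// subr_gt0.
(* This [l] maximises [2 * l * m1 - l^2 * C * m1^2], with maximum [C^-1]. *)
pose l := (C * m1)^-1.
apply: (@le_trans _ _ (2 * l * m1 - l ^+ 2 * m2)).
  have Cm : l * m1 = C^-1 by rewrite /l invfM mulfVK ?gt_eqF.
  have : l ^+ 2 * m2 <= l ^+ 2 * (C * m1 ^+ 2) by rewrite ler_wpM2l ?sqr_ge0.
  have -> : l ^+ 2 * (C * m1 ^+ 2) = C * (l * m1) ^+ 2 by ring.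
  rewrite -mulrA Cm; have -> : C * C^-1 ^+ 2 = C^-1 by field; rewrite gt_eqF.
  by set c := C^-1; lra.
rewrite pr_uncovered /m1 /m2 !mulr_sumr -sumrB [leRHS]big_mkcond/=.
apply: ler_sum => g _; have := prod_wt_ge0 g; set a := prod_wt g => a0.
have -> : 2 * l * (a * nmissed g) - l ^+ 2 * (a * nmissed g ^+ 2) =
    a * (1 - (1 - l * nmissed g) ^+ 2) by ring.
case: ifP => [_|/negbT].
  by rewrite ler_piMr// gerBl sqr_ge0.
rewrite negb_exists => /forallP H.
rewrite (_ : nmissed g = 0); first by rewrite mulr0 subr0 expr1n subrr mulr0.
by rewrite /nmissed big1// => x _; rewrite (negbTE (H x)).
Qed.

Lemma pr_uncovered_ge k (D : R) : 0 < D -> phit <= 2^-1 ->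
  \sum_(h < n) expR (8 * k%:R / n%:R * tsum (tailR P Rv) h n) <= D * n%:R ->
  (2 * D)^-1 <= pr P [set w | ~ covered n Rv U w k].
Proof.
move=> D0 p2 hD; set e := fun h : nat => expR (8 * k%:R / n%:R * tsum (tailR P Rv) h n).
have n0 : 0 < n%:R :> R by rewrite ltr0n.
apply: pr_uncovered_second; first by rewrite mulr_gt0.
  by apply: le_lt_trans p2 _; rewrite invf_lt1 ?ltr1n.
have p0 : 0 <= phit by rewrite -(sum_hits ord0) sumr_ge0// => v _; exact: wt_ge0.
have pair x y : (\sum_(v | ~~ hits x v && ~~ hits y v) wt v) ^+ k <=
    (1 - phit) ^+ (2 * k) * (e (val (y - x)) + e (val (x - y))).
  have u0 : 0 <= \sum_(v | ~~ hits x v && ~~ hits y v) wt v.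
    by apply: sumr_ge0 => v _; exact: wt_ge0.
  rewrite exprM; set q := \sum_(v | hits x v && hits y v) wt v.
  have q0 : 0 <= q by apply: sumr_ge0 => v _; exact: wt_ge0.
  (* The left side is [1 - 2 * phit + q <= (1 - phit)^2 + q], and [phit <= 1/2] makes [(1 - phit)^2]
     at least 1/4; hence the 4. *)
  have h1 : \sum_(v | ~~ hits x v && ~~ hits y v) wt v <= (1 - phit) ^+ 2 * expR (4 * q).
    rewrite sum_miss2 -/q; have := expR_ge1Dx (4 * q) => he.
    have : (1 - phit) ^+ 2 * (1 + 4 * q) <= (1 - phit) ^+ 2 * expR (4 * q).
      by rewrite ler_wpM2l// sqr_ge0.
    apply: le_trans; have p4 : 4^-1 <= (1 - phit) ^+ 2.
      by rewrite (_ : 4^-1 = 2^-1 ^+ 2); [rewrite lerXn2r ?nnegrE//; lra|field].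
    have := ler_wpM2r q0 p4.
    have -> : (1 - phit) ^+ 2 * (1 + 4 * q) =
      1 - phit *+ 2 + phit ^+ 2 + 4 * ((1 - phit) ^+ 2 * q) by ring.
    by have := sqr_ge0 phit; lra.
  apply: (@le_trans _ _ (((1 - phit) ^+ 2 * expR (4 * q)) ^+ k)).
    by rewrite lerXn2r// nnegrE// mulr_ge0 ?sqr_ge0 ?expR_ge0.
  rewrite exprMn ler_wpM2l ?(exprn_ge0 _ (sqr_ge0 _))// -expRM_natr.
  have := sum_hits2 x y; rewrite -/q /e.
  set s := tsum _ _ _; set s' := tsum _ _ _ => hq.
  have k0 : 0 <= k%:R / n%:R :> R by rewrite divr_ge0.
  have hk : 4 * q * k%:R <= 4 * (k%:R / n%:R) * (s + s').
    have -> : 4 * (k%:R / n%:R) * (s + s') = 4 * ((s + s') / n%:R) * k%:R by ring.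
    by rewrite ler_wpM2r// ler_wpM2l.
  (* The sum [s + s'] is at most twice the larger term, which turns 4 into 8; the exponential of the
     larger term is one of the two summands. *)
  have [ss|ss] := leP s s'.
    apply: (@le_trans _ _ (expR (8 * k%:R / n%:R * s'))); last first.
      by rewrite lerDr expR_ge0.
    rewrite ler_expR -[8 * _ / _]mulrA; have := ler_wpM2l k0 ss; move: hk.
    by set c := k%:R / n%:R; lra.
  apply: (@le_trans _ _ (expR (8 * k%:R / n%:R * s))); last first.
    by rewrite lerDl expR_ge0.
  rewrite ler_expR -[8 * _ / _]mulrA; have := ler_wpM2l k0 (ltW ss); move: hk.
  by set c := k%:R / n%:R; lra.
apply: (@le_trans _ _ (\sum_(x < n) \sum_(y < n)
    (1 - phit) ^+ (2 * k) * (e (val (y - x)) + e (val (x - y))))).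
  by apply: ler_sum => x _; apply: ler_sum => y _; exact: pair.
(* As [y] runs over Z/n, each of the two differences takes every value once; hence [2 * D] in the
   conclusion. *)
have sumy (x : 'I_n) : \sum_(y < n) (e (val (y - x)) + e (val (x - y))) = 2 * \sum_(h < n) e h.
  have s1 : \sum_(y < n) e (val (y - x)%R) = \sum_(h < n) e h.
    by rewrite (reindex_inj (addIr x)); apply: eq_bigr => h _; rewrite addrK.
  have s2 : \sum_(y < n) e (val (x - y)%R) = \sum_(h < n) e h.
    by rewrite (reindex_inj (inv_inj (subKr x))); apply: eq_bigr => h _; rewrite subKr.
  transitivity (\sum_(y < n) e (val (y - x)%R) + \sum_(y < n) e (val (x - y)%R)).
    by rewrite big_split.
  by rewrite s1 s2 mulr_natl mulr2n.
under eq_bigr do rewrite -mulr_sumr sumy.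
rewrite sumr_const card_ord -[_ *+ n]mulr_natr exprMn -exprM mulnC.
have -> : 2 * D * (n%:R ^+ 2 * (1 - phit) ^+ (k * 2)) =
  (1 - phit) ^+ (k * 2) * (2 * (D * n%:R)) * n%:R by ring.
rewrite ler_pM2r// ler_wpM2l ?ler_pM2l//.
by rewrite exprM sqr_ge0.
Qed.

End FiniteModel.


(** * Poisson arrivals *)

Section Arrivals.
Context {R : realType} {d : measure_display} {Omega : measurableType d}.
Variables (P : probability Omega R) (n : nat).
Variables (Rv U : nat -> Omega -> nat) (E : nat -> Omega -> R).
Hypothesis M : covering_model P n Rv U E.

(** A union bound over finitely many patterns [g], each evaluated by independence; both estimates on
    arrival times are instances. *)
Lemma pr_union_E (T : finType) k (S : pred {ffun 'I_k -> T}) (A : T -> set R)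
    (c : T -> R) :
  (forall x, measurable (A x)) -> (forall i x, pr P (E i @^-1` A x) <= c x) ->
  measurable [set w | exists2 g, S g & forall i : 'I_k, A (g i) (E i w)] /\
  pr P [set w | exists2 g, S g & forall i : 'I_k, A (g i) (E i w)] <=
    \sum_(g | S g) \prod_i c (g i).
Proof.
move=> mA cA.
pose F (g : {ffun 'I_k -> T}) := [set w | forall i : 'I_k, A (g i) (E i w)].
have mF g : measurable (F g).
  by have [] := pr_indep_E M (fun i : 'I_k => mA (g i)).
split; first exact: (measurable_finType S mF).
apply: le_trans (pr_finType_le _ S mF) _; apply: ler_sum => g _.
have [_ ->] := pr_indep_E M (fun i : 'I_k => mA (g i)).
by apply: ler_prod => i _; rewrite pr_ge0 cA.
Qed.

Lemma measurable_arrival k : measurable_fun setT (arrival E k).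
Proof.
rewrite /arrival; apply: measurable_sum => i.
by have [_ [_ _ _ mE _]] := M; have [] := mE i.
Qed.

Lemma measurable_arrival_le k t : measurable [set w | arrival E k w <= t].
Proof.
rewrite (_ : [set w | _] = arrival E k @^-1` `]-oo, t]); last first.
  by apply/seteqP; split=> w /=; rewrite in_itv.
rewrite -[X in measurable X]setTI.
by apply: measurable_arrival => //; exact: measurable_itv.
Qed.

(** Only the law of an interarrival time is prescribed, so positivity holds almost surely; on this
    event arrival times increase. *)
Definition Epos : set Omega := [set w | forall i, 0 < E i w].

Lemma measurable_Epos : measurable Epos.
Proof.
have -> : Epos = \bigcap_i (E i @^-1` `]0, +oo[).
  apply/seteqP; split=> w /= H i; first by rewrite /= in_itv/= andbT.
  by have := H i I; rewrite /= in_itv/= andbT.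
by apply: bigcapT_measurable => i; exact: (meas_E M).
Qed.

Lemma pr_Epos : pr P Epos = 1.
Proof.
suff : pr P (~` Epos) = 0.
  by rewrite prC; [lra|exact: measurable_Epos].
rewrite /pr (_ : ~` Epos = \bigcup_i (~` [set w | 0 < E i w])); last first.
  apply/seteqP; split=> w /=.
    by move/existsNP => [i Hi]; exists i.
  by case=> i _ /= Hi H; apply: Hi.
have mp i : measurable [set w | 0 < E i w].
  rewrite (_ : [set w | _] = E i @^-1` `]0, +oo[); first exact: (meas_E M).
  by apply/seteqP; split=> w /=; rewrite in_itv/= andbT.
suff : P.-negligible (\bigcup_i (~` [set w | 0 < E i w])).
  rewrite negligibleP; first by move->.
  by apply: bigcupT_measurable => i; exact: measurableC.
apply: negligible_bigcup => i; apply/negligibleP; first exact: measurableC.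
have : pr P (~` [set w | 0 < E i w]) = 0 by rewrite prC// (pr_E_gt M)// oppr0 expR0 subrr.
by move=> p0; apply: etrans (prE P (measurableC (mp i))) _; rewrite p0.
Qed.

(* A sum exceeding 6k forces integers [g i] with [2 (g i) < E i] and total at
   least 2k; each such vector has probability at most [prod_i 4^-(g i)]. *)
Lemma arrival_upper k :
  exists2 B : set Omega, measurable B /\ pr P B <= 2^-1 ^+ k &
    forall w, Epos w -> 6 * k%:R < arrival E k w -> B w.
Proof.
pose S := [pred g : {ffun 'I_k -> 'I_(2 * k).+1} | (2 * k <= \sum_i g i)%N].
pose A (j : 'I_(2 * k).+1) : set R := `]2 * (j : nat)%:R, +oo[%classic.
have e2 : 4 <= expR (2 : R).
  have -> : (2 : R) = 1 * 2%:R by rewrite mul1r.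
  by rewrite expRM_natr; have := expR_ge1Dx (1 : R); rewrite expr2; nra.
have [] := @pr_union_E _ k S A (fun j => 4^-1 ^+ j).
- by move=> j; exact: measurable_itv.
- move=> i j; rewrite (_ : _ @^-1` _ = [set w | 2 * (j : nat)%:R < E i w]); last first.
    by apply/seteqP; split=> w; rewrite /A /= in_itv/= andbT.
  have e0 := expR_gt0 (2 : R).
  rewrite (pr_E_gt M) ?mulr_ge0// expRN expRM_natr exprVn lef_pV2 ?posrE ?exprn_gt0//.
  by rewrite lerXn2r ?nnegrE// ltW.
set B := [set w | _] => mB pB; exists B.
  split=> //; apply: le_trans pB _.
  (* Write [4^-g] as [2^-g * 2^-g]. One factor gives [2^-(2 k)] since the total is at least [2 k];
     the other sums to at most 2 per coordinate, so [4^-k * 2^k] is left. *)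
  apply: (@le_trans _ _ (\sum_(g : {ffun 'I_k -> 'I_(2 * k).+1})
      2^-1 ^+ (2 * k) * \prod_i 2^-1 ^+ (g i))).
    rewrite big_mkcond/=; apply: ler_sum => g _; case: ifP => Sg; last first.
      by rewrite mulr_ge0 ?prodr_ge0// => *; rewrite exprn_ge0.
    have -> : \prod_i 4^-1 ^+ (g i) = 2^-1 ^+ (\sum_i g i) * \prod_i 2^-1 ^+ (g i) :> R.
      rewrite -prodrXr -big_split/=; apply: eq_bigr => i _.
      by rewrite -exprMn; congr (_ ^+ _); field.
    rewrite ler_wpM2r ?prodr_ge0//.
    by rewrite ler_wiXn2l// invf_le1// ler1n.
  rewrite -mulr_sumr -(bigA_distr_bigA (fun (_ : 'I_k) (j : 'I_(2 * k).+1) => 2^-1 ^+ j : R)).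
  rewrite prodr_const card_ord exprM -exprMn lerXn2r ?nnegrE//.
    by rewrite mulr_ge0 ?exprn_ge0 ?sumr_ge0// => *; rewrite exprn_ge0.
  have geo m : \sum_(j < m) 2^-1 ^+ j <= 2 - 2 * 2^-1 ^+ m :> R.
    elim: m => [|m IHm]; first by rewrite big_ord0 expr0; lra.
    by rewrite big_ord_recr/= exprS; lra.
  have := geo (2 * k).+1; have : 0 <= 2^-1 ^+ (2 * k).+1 :> R by rewrite exprn_ge0.
  rewrite expr2; set s := \sum_(_ < _) _; lra.
move=> w Ew aw.
have [m mP] : exists m : 'I_k -> nat, forall i, 2 * (m i)%:R < E i w <= 2 * (m i).+1%:R.
  suff /choice[m mP] : forall i : 'I_k, exists m : nat, 2 * m%:R < E i w <= 2 * m.+1%:R.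
    by exists m.
  move=> i; have ex : exists m : nat, E i w <= 2 * m.+1%:R.
    exists (Num.truncn (E i w)); have := truncnS_gt (E i w).
    have : 0 < E i w by exact: Ew.
    by set t := _%:R; lra.
  case: (ex_minnP ex) => m Em min; exists m; rewrite Em andbT ltNge.
  case: m Em min => [|m] Em min; first by rewrite mulr0 -ltNge; exact: Ew.
  by apply/negP => /min; rewrite ltnn.
(* Summing [E i w <= 2 * (m i + 1)] leaves a total of the [m i] above [2 k]. Capping at [2 k] makes
   the patterns finite in number and keeps the total at least [2 k]. *)
pose g : {ffun 'I_k -> 'I_(2 * k).+1} := [ffun i => inord (minn (m i) (2 * k))].
have gE i : g i = minn (m i) (2 * k) :> nat by rewrite ffunE inordK ?ltnS ?geq_minr.
exists g.
  rewrite /S inE /=.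
  have [/existsP[i mi]|/existsPn H] := boolP [exists i, (2 * k <= m i)%N].
    rewrite (bigD1 i)//= gE; lia.
  have : arrival E k w <= \sum_(i < k) 2 * (m i).+1%:R.
    by apply: ler_sum => i _; case/andP: (mP i).
  rewrite -mulr_sumr -natr_sum => /(lt_le_trans aw).
  rewrite -!natrM ltr_nat => h.
  have : (\sum_(i < k) (m i).+1 = \sum_(i < k) m i + k)%N.
    under eq_bigr do rewrite -addn1.
    by rewrite big_split/= sum1_card card_ord.
  move=> e; rewrite e in h; rewrite (eq_bigr m) => [|i _].
    by move: h; set s := (\sum_(i < k) m i)%N; lia.
  by rewrite gE; have := H i; lia.
move=> i; rewrite /A /= in_itv/= andbT gE.
have /andP[+ _] := mP i; apply: le_lt_trans.
by rewrite ler_pM2l// ler_nat geq_minl.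
Qed.

(** If the sum is at most [k / 32], at least half of the terms are at most [1/16], each an event of
    probability at most [1/16]. There are [2^k] patterns, each of probability at most
    [16^(-k/2) = 4^-k]. *)
Lemma arrival_lower k :
  exists2 B : set Omega, measurable B /\ pr P B <= 2^-1 ^+ k &
    forall w, Epos w -> (0 < k)%N -> 32 * arrival E k w <= k%:R -> B w.
Proof.
pose S := [pred g : {ffun 'I_k -> bool} | (k <= 2 * \sum_i g i)%N].
pose A (x : bool) : set R := if x then `]-oo, 16^-1]%classic else setT.
have [] := @pr_union_E _ k S A (fun x => 16^-1 ^+ x).
- by case; [exact: measurable_itv|exact: measurableT].
- move=> i [] /=; last by apply: pr_le1; rewrite preimage_setT.
  have -> : E i @^-1` `]-oo, 16^-1] = ~` [set w | 16^-1 < E i w].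
    apply/seteqP; split=> w /=; rewrite in_itv/= leNgt; first by move/negP.
    by move=> ?; apply/negP.
  rewrite prC ?(pr_E_gt M)//; first by have := expR_ge1Dx (- 16^-1 : R); rewrite expr1; lra.
  rewrite (_ : [set w | _] = E i @^-1` `]16^-1, +oo[); first exact: (meas_E M).
  by apply/seteqP; split=> w /=; rewrite in_itv/= andbT.
set B := [set w | _] => mB pB; exists B.
  split=> //; apply: le_trans pB _.
  apply: (@le_trans _ _ (\sum_(g : {ffun 'I_k -> bool}) 4^-1 ^+ k)).
    rewrite big_mkcond/=; apply: ler_sum => g _; case: ifP => Sg; last by rewrite exprn_ge0.
    rewrite prodrXr (_ : 16^-1 = 4^-1 ^+ 2 :> R); last by field.
    by rewrite -exprM ler_wiXn2l// invf_le1// ler1n.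
  rewrite sumr_const card_ffun card_bool card_ord -[_ *+ (2 ^ k)]mulr_natr natrX -exprMn.
  by rewrite (_ : 4^-1 * 2%:R = 2^-1 :> R)//; field.
move=> w Ew k0 aw; pose c (i : 'I_k) := E i w <= 16^-1; exists [ffun i => c i]; last first.
  by move=> i; rewrite ffunE /A; case: ifP => //= h; rewrite in_itv.
rewrite inE /= leqNgt; apply/negP => h; move: aw; apply/negP; rewrite -ltNge.
have h1 : (\sum_(i < k) c i + \sum_(i < k) ~~ c i = k)%N.
  rewrite -big_split/= (eq_bigr (fun _ => 1%N)) => [|i _]; last by case: (c i).
  by rewrite sum1_card card_ord.
have h2 : (k < 2 * \sum_(i < k) ~~ c i)%N.
  move: h h1; under eq_bigr do rewrite ffunE.
  by set s := (\sum_(i < k) c i)%N; set s' := (\sum_(i < k) ~~ c i)%N; lia.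
have : \sum_(i < k) (~~ c i)%:R * 16^-1 <= arrival E k w.
  apply: ler_sum => i _; have := Ew i; rewrite /c.
  by have [|] := leP (E i w) (16^-1) => /=; lra.
rewrite -mulr_suml -natr_sum; move: h2; rewrite -(@ltr_nat R) natrM.
by set s := (\sum_(_ < _) _)%N; lra.
Qed.

End Arrivals.

(** * Discrete and continuous cover times *)

Section CoverTimes.
Context {R : realType} {d : measure_display} {Omega : measurableType d}.
Variables (P : probability Omega R) (N : nat).
Variables (Rv U : nat -> Omega -> nat) (E : nat -> Omega -> R).
Notation n := N.+1.
Hypothesis M : covering_model P n Rv U E.
Variable F : R.
Hypothesis F_gt0 : 0 < F.

Lemma covered_mono k k' w : (k <= k')%N -> covered n Rv U w k -> covered n Rv U w k'.
Proof.
by move=> kk' H x xn; have [i ik Hi] := H x xn; exists i => //; exact: leq_trans kk'.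
Qed.

Lemma tau_gtE x w : 0 <= x ->
  (x%:E < F%:E * tau n Rv U w)%E <-> ~ covered n Rv U w (Num.truncn (x / F)).
Proof.
move=> x0; have xF : 0 <= x / F by rewrite divr_ge0// ltW.
split.
  move=> xt ck; have : (tau n Rv U w <= ((Num.truncn (x / F))%:R : R)%:E)%E.
    by apply: ge_ereal_inf; exists ((Num.truncn (x / F))%:R : R)%:E => //; exists (Num.truncn (x / F)).
  rewrite -(@lee_pmul2l _ F%:E)// => /(lt_le_trans xt).
  by rewrite -EFinM lte_fin mulrC -ltr_pdivrMr// ltNge truncn_le xF.
move=> nck; apply: (@lt_le_trans _ _ (F%:E * (Num.truncn (x / F)).+1%:R%:E)%E).
  by rewrite -EFinM lte_fin mulrC -ltr_pdivrMr// truncnS_gt.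
rewrite lee_pmul2l// /tau; apply: le_ereal_inf_tmp => _ [k /= ck <-].
rewrite lee_fin ler_nat ltnNge; apply/negP => kle.
by apply: nck; exact: covered_mono ck.
Qed.

Lemma PoissonNE t w : PoissonN E t w =
  (\sum_(m <oo | (0 < m)%N && (arrival E m w <= t)%R) 1)%E.
Proof.
rewrite nneseries_esum// /PoissonN; congr (esum _ _).
by apply/seteqP; split=> m /= => [[-> ->]|/andP[]].
Qed.

Lemma PoissonN_ge t w k : (forall m, (0 < m <= k)%N -> arrival E m w <= t) ->
  (k%:R%:E <= PoissonN E t w)%E.
Proof.
move=> H; rewrite PoissonNE.
apply: le_trans (nneseries_lim_ge k.+1 _) => //.
rewrite big_ltn_cond//= big_nat_cond (eq_bigl (fun i => (1 <= i < k.+1)%N)); last first.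
  by move=> i; apply/andb_idr => /andP[i0 ik]; rewrite i0 H// i0.
rewrite -(@big_nat _ _ _ 1 k.+1 (fun=> 1%:E : \bar R)) sumEFin lee_fin big_const_nat iter_addr.
by rewrite addr0 subn1.
Qed.

Lemma PoissonN_gt t w k : (k.+1%:R%:E <= PoissonN E t w)%E ->
  exists2 m, (k < m)%N & arrival E m w <= t.
Proof.
move=> kN; apply: contrapT => H.
have {}H m : (k < m)%N -> (arrival E m w <= t) = false.
  by move=> km; apply/negP => mt; apply: H; exists m.
suff : (PoissonN E t w <= k%:R%:E)%E.
  by move=> /(le_trans kN); rewrite lee_fin ler_nat ltnn.
rewrite PoissonNE; apply: lime_le; first exact: is_cvg_nneseries_cond.
apply: nearW => m.
rewrite (_ : \sum_(_ <= _ < m | _) _ = (\sum_(0 <= i < m | (0 < i)%N && (arrival E i w <= t)%R) 1)%:E)%E; last by rewrite sumEFin.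
rewrite lee_fin (_ : \sum_(_ <= _ < _ | _) _ =
  (\sum_(0 <= i < m | (0 < i)%N && (arrival E i w <= t)%R) 1)%N%:R); last by rewrite natr_sum.
rewrite ler_nat big_mkcond/=.
(* Index 0 is not counted and no index above [k] is, so a partial sum up to [m] counts at most
   [minn m.-1 k] arrivals. *)
suff : (\sum_(0 <= i < m) (if (0 < i)%N && (arrival E i w <= t)%R then 1 else 0)
   <= minn m.-1 k)%N by move/leq_trans; apply; exact: geq_minr.
elim: m => [|m IHm]; first by rewrite big_nil.
rewrite big_nat_recr//=; have := H m; case: (arrival E m w <= t).
  by case: (ltnP 0 m) => /=; case: (ltnP k m) => // h1 h2 h3; move: IHm;
    set s := (\sum_(_ <= _ < _) _)%N; [by have := h3 isT|lia..].
by rewrite andbF addn0 => _; apply: leq_trans IHm _; rewrite leq_min geq_minr andbT; lia.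
Qed.

Lemma measurable_PoissonN_ge t k : measurable [set w | (k%:R%:E <= PoissonN E t w)%E].
Proof.
pose A m : set Omega := [set w | (0 < m)%N /\ arrival E m w <= t].
have mA m : measurable (A m).
  have [->|m0] := posnP m.
    by rewrite (_ : A 0%N = set0)//; apply/seteqP; split=> w // [].
  rewrite (_ : A m = [set w | arrival E m w <= t]); first exact: measurable_arrival_le M _ _.
  by apply/seteqP; split=> w // [].
have mN : measurable_fun [set: Omega] (PoissonN E t : Omega -> \bar R).
  rewrite (_ : PoissonN E t = fun w => (\sum_(m <oo | m \in xpredT) (\1_(A m) w)%:E)%E).
    apply: ge0_emeasurable_sum => // m _; apply/measurable_EFinP.
    exact: measurable_indic.
  apply/funext => w; rewrite PoissonNE eseries_mkcond; apply: eq_eseriesr => m _.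
  rewrite indicE; case: ifPn => [/andP[m0 mt]|h]; first by rewrite mem_set.
  by rewrite memNset// => -[m0 mt]; rewrite m0 mt in h.
rewrite (_ : [set w | _] = setT `&` PoissonN E t @^-1` `[k%:R%:E, +oo[); last first.
  by rewrite setTI; apply/seteqP; split=> w /=; rewrite in_itv/= andbT.
by apply: mN => //; exact: emeasurable_itv.
Qed.

Lemma measurable_Xfull t : measurable [set w | Xfull n Rv U E t w].
Proof.
rewrite (_ : [set w | _] = \bigcup_k ([set w | (k%:R%:E <= PoissonN E t w)%E] `&`
    [set w | covered n Rv U w k])); last first.
  by apply/seteqP; split=> w [k] => [[h1 h2]|_ [h1 h2]]; exists k.
apply: bigcupT_measurable => k; apply: measurableI.
  exact: measurable_PoissonN_ge.
exact: measurable_covered M k.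
Qed.

Lemma Xfull_mono s t w : s <= t -> Xfull n Rv U E s w -> Xfull n Rv U E t w.
Proof.
move=> st [k [kN ck]]; exists k; split=> //; apply: le_trans kN _.
rewrite /PoissonN esum_mkcond [leRHS]esum_mkcond; apply: le_esum => m _.
case: ifPn => [|_]; last by case: ifP.
by move=> /set_mem[m0 ms]; rewrite mem_set//; split=> //; exact: le_trans st.
Qed.

Lemma Tcont_ge0 w : (0 <= Tcont n Rv U E w)%E.
Proof. by rewrite /Tcont; apply: le_ereal_inf_tmp => _ [t [t0 _] <-]; rewrite lee_fin. Qed.

(** The infimum is not known to be attained, so the event is tested at countably many times
    decreasing to [x / F]; this form also gives measurability. *)
Lemma Tcont_leE x w : (F%:E * Tcont n Rv U E w <= x%:E)%E <->
  0 <= x /\ forall j : nat, Xfull n Rv U E (x / F + j.+1%:R^-1) w.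
Proof.
rewrite muleC -lee_pdivlMr// -EFinM; split.
  move=> Tx; split.
    have := le_trans (Tcont_ge0 w) Tx.
    by rewrite lee_fin pmulr_lge0 ?invr_gt0.
  move=> j; have : (Tcont n Rv U E w < (x / F + j.+1%:R^-1)%:E)%E.
    by apply: le_lt_trans Tx _; rewrite lte_fin ltrDl invr_gt0.
  move=> /ereal_inf_lt[_ [t [t0 tX] <-]]; rewrite lte_fin => /ltW tj.
  exact: Xfull_mono tX.
move=> [x0 H]; apply/lee_addgt0Pr => e e0.
pose j := Num.truncn e^-1.
have je : j.+1%:R^-1 <= e.
  by rewrite invf_ple ?posrE// ltW// truncnS_gt.
apply: (@le_trans _ _ (x / F + j.+1%:R^-1)%:E); last by rewrite -EFinD lee_fin lerD2l.
apply: ge_ereal_inf; exists (x / F + j.+1%:R^-1)%:E => //; exists (x / F + j.+1%:R^-1) => //; split=> //.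
by rewrite addr_ge0// divr_ge0// ltW.
Qed.

Definition T_le x : set Omega := [set w | (F%:E * Tcont n Rv U E w <= x%:E)%E].

Lemma T_le_neg x : x < 0 -> T_le x = set0.
Proof.
by move=> x0; apply/seteqP; split=> w // /Tcont_leE[]; rewrite leNgt x0.
Qed.

Lemma measurable_T_le x : measurable (T_le x).
Proof.
have [x0|x0] := ltP x 0; first by rewrite T_le_neg.
rewrite (_ : T_le x = \bigcap_j [set w | Xfull n Rv U E (x / F + j.+1%:R^-1) w]).
  by apply: bigcapT_measurable => j; exact: measurable_Xfull.
apply/seteqP; split=> w; first by move=> /Tcont_leE[_ H] j _; exact: H.
by move=> H; apply/Tcont_leE; split=> // j; exact: H.
Qed.

Lemma arrival_mono m k w : Epos E w -> (k <= m)%N -> arrival E k w <= arrival E m w.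
Proof.
move=> Ew km; rewrite /arrival -!(big_mkord xpredT (fun i => E i w)).
rewrite [leRHS](@big_cat_nat _ _ _ k)//= lerDl sumr_ge0// => i _.
by have := Ew i; exact: ltW.
Qed.

Lemma pr_T_le_ge x k : 6 * k%:R * F <= x ->
  1 - pr P [set w | ~ covered n Rv U w k] - 2^-1 ^+ k <= pr P (T_le x).
Proof.
move=> kx; have [B [mB pB] HB] := arrival_upper M k.
have mnc := measurableC (measurable_covered M k).
have mEp := measurable_Epos M.
have x0 : 0 <= x by apply: le_trans kx; rewrite !mulr_ge0// ltW.
have sub : ~` (T_le x) `<=` (~` [set w | covered n Rv U w k] `|` B) `|` ~` (Epos E).
  move=> w nT; apply: contrapT => /not_orP[/not_orP[/contrapT ck nB] /contrapT Ew].
  apply: nT; apply/Tcont_leE; split=> // j; exists k; split=> //.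
  apply: PoissonN_ge => m /andP[_ mk]; apply: le_trans (arrival_mono Ew mk) _.
  have : arrival E k w <= 6 * k%:R.
    by rewrite leNgt; apply/negP => h; apply: nB; exact: HB.
  have : 6 * k%:R <= x / F by rewrite ler_pdivlMr.
  have : 0 <= j.+1%:R^-1 :> R by [].
  by set u := x / F; set v := j.+1%:R^-1; lra.
have := pr_le P (measurableC (measurable_T_le x)) (measurableU _ _ (measurableU _ _ mnc mB) (measurableC mEp)) sub.
rewrite prC; last exact: measurable_T_le.
have := prU2 P (measurableU _ _ mnc mB) (measurableC mEp).
have := prU2 P mnc mB.
rewrite (prC P mEp) (pr_Epos M) subrr.
rewrite -/(pr P _) (_ : [set w | ~ _] = ~` [set w | covered n Rv U w k])//.
lra.
Qed.

Lemma pr_T_le_le x k : 0 < x -> (0 < k)%N -> 64 * x <= k%:R * F ->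
  pr P (T_le x) <= 1 - pr P [set w | ~ covered n Rv U w k] + 2^-1 ^+ k.
Proof.
move=> x0 k0 kx; have [B [mB pB] HB] := arrival_lower M k.
have mc := measurable_covered M k.
have mEp := measurable_Epos M.
have xF : 0 < x / F by rewrite divr_gt0.
have sub : T_le x `<=` ([set w | covered n Rv U w k] `|` B) `|` ~` (Epos E).
  move=> w /Tcont_leE[_ H]; apply: contrapT => /not_orP[/not_orP[nck nB] /contrapT Ew].
  (* The surplus [j.+1^-1] is then at most [x / F], so the time is at most [2 * x / F]; against
     [k / 32] this accounts for the constant 64. *)
  pose j := Num.truncn (x / F)^-1.
  have je : j.+1%:R^-1 <= x / F by rewrite invf_ple ?posrE// ltW// truncnS_gt.
  have [k' [kN ck']] := H j; have [kk|kk] := leqP k' k.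
    by apply: nck; exact: covered_mono ck'.
  have [m km ma] : exists2 m, (k < m)%N & arrival E m w <= x / F + j.+1%:R^-1.
    by apply: PoissonN_gt; apply: le_trans kN; rewrite lee_fin ler_nat.
  apply: nB; apply: HB => //; have := arrival_mono Ew (ltnW km).
  have : 64 * (x / F) <= k%:R by rewrite mulrA ler_pdivrMr.
  by move: ma je; set u := x / F; set v := j.+1%:R^-1; lra.
have := pr_le P (measurable_T_le x) (measurableU _ _ (measurableU _ _ mc mB) (measurableC mEp)) sub.
have := prU2 P (measurableU _ _ mc mB) (measurableC mEp).
have := prU2 P mc mB.
rewrite (prC P mEp) (pr_Epos M) subrr.
rewrite (_ : [set w | ~ _] = ~` [set w | covered n Rv U w k])// (prC P mc).
lra.
Qed.

End CoverTimes.

(** * Limit laws *)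

Section LimitLaws.
Context {R : realType}.
Variable Y : probability R R.

(** Convergence in distribution is tested only at points without mass. The atoms are countable, so
    they cannot fill an interval of positive Lebesgue measure. *)
Lemma non_atom (a c : R) : a < c -> exists2 x, a < x < c & Y [set x] = 0%E.
Proof.
move=> ac; apply: contrapT => H.
pose X : {RV Y >-> R} := HB.pack (id : R -> R)
  (isMeasurableFun.Build _ _ R R (id : R -> R) (@measurable_id _ R setT)).
have sub : `]a, c[%classic `<=` [set r | 0 < pmf X r].
  move=> x /=; rewrite in_itv/= => xac; rewrite lt_neqAle fine_ge0// andbT.
  apply/eqP => p0; apply: H; exists x => //.
  by rewrite -[LHS]fineK ?fin_num_measure//; congr EFin; rewrite [RHS]p0.
have /countable_lebesgue_measure0 := sub_countable (subset_card_le sub) (pmf_gt0_countable X).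
rewrite lebesgue_measure_itv/= lte_fin ac -EFinB => /eqP.
by rewrite eqe subr_eq0 gt_eqF.
Qed.

Lemma pr_Y_gt x : pr Y [set y | x < y] = 1 - pr Y [set y | y <= x].
Proof.
rewrite -prC; last by rewrite -[X in measurable X]set_itvNyc; exact: measurable_itv.
by congr (pr Y _); apply/seteqP; split=> y /=; rewrite ltNge => /negP.
Qed.

Lemma law_support_closed : closed (law_support Y).
Proof.
rewrite -openC openE => y /=.
rewrite /law_support/= => /existsNP[e /not_implyP[e0 /negP]].
rewrite -leNgt => Ye.
exists (e / 2); first by rewrite /= divr_gt0.
move=> z yz zs; have e20 : 0 < e / 2 by rewrite divr_gt0.
have := zs _ e20; rewrite ltNge => /negP; apply.
apply: le_trans Ye; apply: le_measure; rewrite ?inE; [exact: measurable_ball..|].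
move=> u zu; have := @ball_triangle _ _ z y u (e / 2) (e / 2) yz zu.
by rewrite -splitr.
Qed.

Lemma law_support_compact (s t : R) :
  pr Y [set y | y < s] = 0 -> pr Y [set y | t < y] = 0 -> compact (law_support Y).
Proof.
(* The margin 1 puts the unit ball around any point outside the segment inside a null half-line. *)
move=> Ys Yt; apply: (@subclosed_compact _ _ `[s - 1, t + 1]%classic).
- exact: law_support_closed.
- exact: segment_compact.
have mlt : measurable [set y : R | y < s].
  by rewrite -[X in measurable X]set_itvNyo; exact: measurable_itv.
have mgt : measurable [set y : R | t < y].
  by rewrite -[X in measurable X]set_itvoy; exact: measurable_itv.
have null (A : set R) y : measurable A -> pr Y A = 0 -> law_support Y y -> ~ (ball y 1 `<=` A).
  move=> mA YA /(_ 1 ltr01) + yA; rewrite ltNge => /negP; apply.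
  have := pr_le Y (measurable_ball y 1) mA yA.
  by rewrite YA -lee_fin -prE//; exact: measurable_ball.
move=> y ys; rewrite /= in_itv/=; apply/andP; split; rewrite leNgt; apply/negP => h.
  apply: (null _ _ mlt Ys ys) => z; rewrite /ball/= ltr_norml => /andP[? ?]; lra.
apply: (null _ _ mgt Yt ys) => z; rewrite /ball/= ltr_norml => /andP[? ?]; lra.
Qed.

End LimitLaws.

Lemma half_pow_lt (R : realType) (e : R) : 0 < e ->
  exists K : nat, forall k, (K <= k)%N -> 2^-1 ^+ k < e.
Proof.
move=> e0; exists (Num.truncn e^-1).+1 => k kK.
rewrite exprVn invf_plt ?posrE ?exprn_gt0//; apply: lt_le_trans (truncnS_gt _) _.
by rewrite -natrX ler_nat; apply: leq_trans kK _; exact/ltnW/ltn_expl.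
Qed.

(** * Tightness and uniform estimates on the scale [1 / f n] *)

Section Asymptotics.
Context {R : realType} {b : R} {d : measure_display} {Omega : measurableType d}.
Variables (P : probability Omega R) (Rv : nat -> Omega -> nat).
Variables (U : nat -> nat -> Omega -> nat) (E : nat -> Omega -> R).
Hypothesis b_gt : -1 < b.
Hypothesis M : forall n, (0 < n)%N -> covering_model P n Rv (U n) E.
Hypothesis f_reg : exists r0 : nat, forall r : nat, (r0 <= r)%N ->
  tailR P Rv r = Num.min ((ln (r%:R : R)) `^ b / r%:R) 1.
Notation f := (tailR P Rv).

Let measurable_tail r : measurable [set w | (r <= Rv 0%N w)%N].
Proof. exact: (meas_Rv (M (ltn0Sn 0)) 0 [set m | (r <= m)%N]). Qed.

Lemma tailR_ge0 r : 0 <= f r.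
Proof. exact: pr_ge0. Qed.

Lemma tailR_le1 r : f r <= 1.
Proof. exact: (pr_le1 P (measurable_tail r)). Qed.

Lemma tailR_anti r s : (r <= s)%N -> f s <= f r.
Proof.
by move=> rs; apply: (pr_le P) => // w /=; exact: leq_trans.
Qed.

Lemma tailR_lim e : 0 < e -> exists N, forall n, (N <= n)%N -> f n < e.
Proof.
move=> e0; pose A r : set Omega := [set w | (r <= Rv 0%N w)%N].
have capA : \bigcap_r A r = set0.
  by apply/seteqP; split=> w // /(_ (Rv 0%N w).+1 I); rewrite /A/= ltnn.
have : (P \o A) x @[x --> \oo] --> P (\bigcap_r A r).
  apply: nonincreasing_cvg_mu.
  - by rewrite -ge0_fin_numE// fin_num_measure//; exact: measurable_tail.
  - exact: measurable_tail.
  - by rewrite capA.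
  - by move=> r s rs; apply/subsetPset => w /=; exact: leq_trans.
rewrite capA measure0 => /fine_cvg /cvgrPdist_lt/(_ e e0)[N _ H].
exists N => n nN; have := H n nN.
by rewrite /= sub0r normrN ger0_norm ?tailR_ge0.
Qed.

Lemma tailR_gt0 n : 0 < f n.
Proof.
have [N fN] := tail_eq tailR_lim f_reg.
have := @tailR_anti n (maxn n (maxn 2 N)) (leq_maxl _ _); apply: lt_le_trans.
have m2 : (1 < maxn n (maxn 2 N))%N by rewrite !leq_max leqnn orbT.
rewrite fN; last by rewrite !leq_max leqnn !orbT.
by rewrite divr_gt0 ?powR_gt0 ?ln_gt0 ?ltr1n// ltr0n; exact: ltnW.
Qed.

Definition objs (c : R) n := Num.truncn (c / f n).

Lemma objs_le c n : 0 <= c -> (objs c n)%:R * f n <= c.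
Proof.
by move=> c0; rewrite -ler_pdivlMr ?tailR_gt0// truncn_le divr_ge0// tailR_ge0.
Qed.

Lemma objs_gt c n : c - f n < (objs c n)%:R * f n.
Proof.
rewrite ltrBlDr -{2}[f n]mul1r -mulrDl -ltr_pdivrMr ?tailR_gt0//.
by rewrite natr1 truncnS_gt.
Qed.

Lemma objs_large c K : 0 < c -> exists N : nat, forall n, (N <= n)%N -> (K <= objs c n)%N.
Proof.
move=> c0; have [N fN] := tailR_lim (divr_gt0 c0 (ltr0Sn R K)).
exists N => n /fN; rewrite ltr_pdivlMr// mulrC -ltr_pdivlMr ?tailR_gt0// => /ltW h.
rewrite /objs truncn_ge_nat; last by rewrite divr_ge0 ?tailR_ge0// ltW.
by apply: le_trans h; rewrite ler_nat.
Qed.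

Lemma half_pow_objs (c e : R) : 0 < c -> 0 < e ->
  exists N : nat, forall n, (N <= n)%N -> 2^-1 ^+ (objs c n) < e.
Proof.
move=> c0 /half_pow_lt[K HK]; have [N HN] := objs_large K c0.
by exists N => n /HN /HK.
Qed.

Lemma onem_exp_le (x : R) k : 0 <= x <= 1 -> (1 - x) ^+ k <= expR (- (k%:R * x)).
Proof.
move=> /andP[x0 x1]; rewrite mulrC -mulNr expRM_natr lerXn2r ?nnegrE ?expR_ge0//.
  by rewrite subr_ge0.
by have := expR_ge1Dx (- x).
Qed.

Lemma tau_tight eps : 0 < eps -> exists K : R, forall n : nat, (0 < n)%N ->
  (P [set w | (K%:E < (f n)%:E * tau n Rv (U n) w)%E] <= eps%:E)%E.
Proof.
(* The [1] pays for rounding: [objs K n * f n] exceeds [K - f n >= K - 1]. *)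
move=> e0; pose K := Num.max 0 (1 - ln eps).
have K0 : 0 <= K by rewrite le_max lexx.
exists K => -[//|n] _; have Mn := M (ltn0Sn n).
have fn0 := tailR_gt0 n.+1.
have -> : [set w | (K%:E < (f n.+1)%:E * tau n.+1 Rv (U n.+1) w)%E] =
    ~` [set w | covered n.+1 Rv (U n.+1) w (objs K n.+1)].
  by apply/seteqP; split=> w /(tau_gtE _ _ _ fn0 _ K0).
rewrite prE; last exact/measurableC/(measurable_covered Mn).
rewrite lee_fin; apply: le_trans (pr_uncovered_large Mn _) _.
apply: le_trans (onem_exp_le _ _) _; first by rewrite tailR_ge0 tailR_le1.
rewrite -[leRHS](lnK e0) ler_expR.
have := objs_gt K n.+1; have := tailR_le1 n.+1.
have : 1 - ln eps <= K by rewrite le_max lexx orbT.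
lra.
Qed.

Notation Tset n x :=
  [set w | ((f n)%:E * Tcont n Rv (U n) E w <= x%:E)%E].

Lemma measurable_Tset n x : (0 < n)%N -> measurable (Tset n x).
Proof. by case: n => // n _; exact: (measurable_T_le (M (ltn0Sn n)) (tailR_gt0 _)). Qed.

Lemma Tset_neg n x : (0 < n)%N -> x < 0 -> Tset n x = set0.
Proof. by case: n => // n _; apply: T_le_neg; exact: tailR_gt0. Qed.

Lemma T_small_likely x : 0 < x -> exists2 c : R, 0 < c &
  exists N : nat, forall n, (N <= n)%N -> (0 < n)%N -> c <= pr P (Tset n x).
Proof.
move=> x0; have x6 : 0 < x / 6 by rewrite divr_gt0.
pose e := expR (- (x / 12)); have e1 : e < 1 by rewrite expR_lt1 oppr_lt0 divr_gt0.
have x12 : 0 < x / 12 by rewrite divr_gt0.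
have e20 : 0 < (1 - e) / 2 by lra.
have [N1 H1] := half_pow_objs x6 e20; have [N2 H2] := tailR_lim x12.
exists ((1 - e) / 2) => //; exists (maxn N1 N2) => -[//|n]; rewrite geq_max => /andP[n1 n2] _.
have kx : 6 * (objs (x / 6) n.+1)%:R * f n.+1 <= x.
  by have := objs_le n.+1 (ltW x6); lra.
apply: le_trans (pr_T_le_ge (M (ltn0Sn n)) (tailR_gt0 n.+1) kx).
have h1 := H1 _ n1; have h2 := H2 _ n2; have h3 := objs_gt (x / 6) n.+1.
have := pr_uncovered_large (M (ltn0Sn n)) (objs (x / 6) n.+1).
have := @onem_exp_le (f n.+1) (objs (x / 6) n.+1).
rewrite tailR_ge0 tailR_le1 => /(_ isT).
have : expR (- ((objs (x / 6) n.+1)%:R * f n.+1)) <= e by rewrite ler_expR; lra.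
lra.
Qed.

(** The threshold [s] does not depend on [e]; this is what bounds the support, beyond mere
    tightness. *)
Lemma T_bounded : exists2 s : R, 0 < s & forall x e, s <= x -> 0 < e ->
  exists N : nat, forall n, (N <= n)%N -> (0 < n)%N -> 1 - e <= pr P (Tset n x).
Proof.
have [c c0 [N1 H1]] := tsum_ge tailR_ge0 tailR_lim f_reg.
have [N2 H2] := tsum_le_half tailR_le1 tailR_lim.
(* With [(1 + 2 / c) / f n] objects, the [1] covering rounding, the number of objects times the
   hitting probability is at least [2 * ln n], so the mean number of missed points is at most
   [1 / n]. The 6 comes from the clock. *)
exists (6 * (1 + 2 / c)).
  by rewrite mulr_gt0// addr_gt0// divr_gt0.
move=> x e sx e0; have c2 : 0 < 2 / c by rewrite divr_gt0.
pose s := 1 + 2 / c; have s0 : 0 < s by rewrite /s; lra.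
have e2 : 0 < e / 2 by rewrite divr_gt0.
have [N3 H3] := half_pow_objs s0 e2.
pose N4 := (Num.truncn (e / 2)^-1).+1.
exists (maxn (maxn N1 N2) (maxn N3 N4)) => -[//|n].
rewrite !geq_max => /andP[/andP[n1 n2] /andP[n3 n4]] _.
have kx : 6 * (objs s n.+1)%:R * f n.+1 <= x.
  by have := objs_le n.+1 (ltW s0); move: sx; rewrite -/s; lra.
apply: le_trans (pr_T_le_ge (M (ltn0Sn n)) (tailR_gt0 n.+1) kx).
have n0 : 0 < n.+1%:R :> R by [].
pose p := phit P n Rv.
have p2 : p <= 2^-1.
  by rewrite /p /phit ler_pdivrMr// mulrC; exact: H2.
have pge : c * f n.+1 * ln n.+1%:R <= p.
  rewrite /p /phit ler_pdivlMr//; have := H1 _ n1.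
  by rewrite (_ : c * (n.+1%:R * f n.+1) * ln n.+1%:R = c * f n.+1 * ln n.+1%:R * n.+1%:R)//; ring.
have l0 : 0 <= ln (n.+1%:R : R) by rewrite ln_ge0// ler1n.
have p0 : 0 <= p by apply: le_trans pge; rewrite !mulr_ge0 ?tailR_ge0// ltW.
have h3 := H3 _ n3.
have := pr_uncovered_first (M (ltn0Sn n)) (objs s n.+1); rewrite -/p.
have kp : 2 * ln n.+1%:R <= (objs s n.+1)%:R * p.
  have := objs_gt s n.+1; have := tailR_le1 n.+1; rewrite /s => f1 hs.
  have {hs f1}kf : 2 / c <= (objs s n.+1)%:R * f n.+1 by rewrite /s; lra.
  apply: le_trans (ler_wpM2l (ler0n _ _) pge).
  rewrite (_ : _ * (c * _ * _) = (objs s n.+1)%:R * f n.+1 * (c * ln n.+1%:R)); last by ring.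
  apply: le_trans (ler_wpM2r _ kf); last by rewrite mulr_ge0// ltW.
  by rewrite (_ : 2 / c * (c * _) = 2 * ln n.+1%:R)//; field; rewrite gt_eqF.
have : n.+1%:R * (1 - p) ^+ objs s n.+1 <= e / 2.
  apply: (@le_trans _ _ (n.+1%:R * expR (- (2 * ln n.+1%:R)))).
    rewrite ler_pM2l//; apply: le_trans (onem_exp_le _ _) _; first by rewrite p0; lra.
    by rewrite ler_expR lerN2.
  rewrite expRN (_ : 2 * ln n.+1%:R = ln n.+1%:R + ln n.+1%:R); last by ring.
  rewrite expRD lnK ?posrE// invfM mulrA divff ?gt_eqF// mul1r.
  rewrite invf_ple ?posrE//; apply/ltW/(lt_le_trans (truncnS_gt _)).
  by rewrite ler_nat; exact: leq_trans n4 _.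
lra.
Qed.

Lemma T_not_small : exists2 x : R, 0 < x & exists2 c : R, 0 < c &
  exists N : nat, forall n, (N <= n)%N -> (0 < n)%N -> pr P (Tset n x) <= 1 - c.
Proof.
have [s s0 [N1 H1]] := sum_exp_tsum b_gt tailR_le1 tailR_lim f_reg.
have [N2 H2] := tsum_le_half tailR_le1 tailR_lim.
pose D : R := 2 * expR 2^-1; have D0 : 0 < D by rewrite mulr_gt0 ?expR_gt0.
pose c := (2 * D)^-1; have c0 : 0 < c by rewrite invr_gt0 mulr_gt0.
have c20 : 0 < c / 2 by rewrite divr_gt0.
have s2 : 0 < s / 2 by rewrite divr_gt0.
have [N3 H3] := half_pow_objs s0 c20; have [N4 H4] := tailR_lim s2.
have [N5 H5] := objs_large 1 s0.
(* Rounding leaves [objs s n * f n > s / 2], which is 64 times this value. Half of [c] is given up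
   to the error of the clock. *)
exists (s / 128); first by rewrite divr_gt0.
exists (c / 2) => //; exists (maxn (maxn N1 N2) (maxn N3 (maxn N4 N5))) => -[//|n].
rewrite !geq_max => /andP[/andP[n1 n2] /and3P[n3 n4 n5]] _.
have x0 : 0 < s / 128 by rewrite divr_gt0.
have kx : 64 * (s / 128) <= (objs s n.+1)%:R * f n.+1.
  by have := objs_gt s n.+1; have := H4 _ n4; lra.
apply: le_trans (pr_T_le_le (M (ltn0Sn n)) (tailR_gt0 n.+1) x0 (H5 _ n5) kx) _.
have p2 : phit P n Rv <= 2^-1 by rewrite /phit ler_pdivrMr// mulrC; exact: H2.
have := pr_uncovered_ge (M (ltn0Sn n)) D0 p2 (H1 _ _ n1 (objs_le n.+1 (ltW s0))).
have := H3 _ n3; rewrite -/c; lra.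
Qed.

(** * Properties of subsequential limits *)

Section Subsequence.
Variables (nk : nat -> nat) (Y : probability R R).
Hypothesis nkS : forall k, (nk k < nk k.+1)%N.
Hypothesis cvgY : cvg_in_distribution P
  (fun k w => ((f (nk k))%:E * Tcont (nk k) Rv (U (nk k)) E w)%E) Y.

Lemma nk_ge k : (k <= nk k)%N.
Proof. by elim: k => // k IHk; exact: leq_ltn_trans IHk (nkS k). Qed.

Lemma measurable_Yle x : measurable [set y : R | y <= x].
Proof. by rewrite -[X in measurable X]set_itvNyc; exact: measurable_itv. Qed.

Lemma limit_ge x c : Y [set x] = 0%E ->
  (exists N, forall n, (N <= n)%N -> (0 < n)%N -> c <= pr P (Tset n x)) ->
  c <= pr Y [set y | y <= x].
Proof.
move=> Yx [N HN]; have cv := cvgY Yx.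
rewrite -lee_fin -prE; last exact: measurable_Yle.
rewrite -(cvg_lim _ cv)//; apply: lime_ge; first by apply/cvg_ex; eexists; exact: cv.
exists N.+1 => // k /= Nk; have nk0 : (N < nk k)%N := leq_trans Nk (nk_ge k).
rewrite prE; last by apply: measurable_Tset; exact: leq_ltn_trans nk0.
by rewrite lee_fin HN//; [exact: ltnW|exact: leq_ltn_trans nk0].
Qed.

Lemma limit_le x c : Y [set x] = 0%E ->
  (exists N, forall n, (N <= n)%N -> (0 < n)%N -> pr P (Tset n x) <= c) ->
  pr Y [set y | y <= x] <= c.
Proof.
move=> Yx [N HN]; have cv := cvgY Yx.
rewrite -lee_fin -prE; last exact: measurable_Yle.
rewrite -(cvg_lim _ cv)//; apply: lime_le; first by apply/cvg_ex; eexists; exact: cv.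
exists N.+1 => // k /= Nk; have nk0 : (N < nk k)%N := leq_trans Nk (nk_ge k).
rewrite prE; last by apply: measurable_Tset; exact: leq_ltn_trans nk0.
by rewrite lee_fin HN//; [exact: ltnW|exact: leq_ltn_trans nk0].
Qed.

Lemma limit_neg x : x < 0 -> Y [set x] = 0%E -> pr Y [set y | y <= x] = 0.
Proof.
move=> x0 Yx; apply/eqP; rewrite eq_le pr_ge0 andbT; apply: limit_le => //.
by exists 0%N => n _ n0; rewrite Tset_neg// /pr measure0.
Qed.

Lemma limit_non_degenerate : non_degenerate Y.
Proof.
move=> [c Yc].
have prc : pr Y [set c] = 1 by rewrite /pr Yc.
have atom x : x != c -> Y [set x] = 0%E.
  move=> xc; rewrite prE//; congr EFin; apply/eqP; rewrite eq_le pr_ge0 andbT.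
  have : pr Y [set x] <= pr Y (~` [set c]).
    apply: pr_le => //; first exact: measurableC.
    by move=> y /= ->; exact/eqP.
  by rewrite prC// prc subrr.
have Y1 x : c <= x -> 1 <= pr Y [set y | y <= x].
  move=> cx; rewrite -prc; apply: pr_le => //; first exact: measurable_Yle.
  by move=> y /= ->.
have Y0 x : x < c -> pr Y [set y | y <= x] <= 0.
  move=> xc; have : pr Y [set y | y <= x] <= pr Y (~` [set c]).
    apply: pr_le; [exact: measurable_Yle|exact: measurableC|].
    by move=> y /= yx yc; move: xc; rewrite -yc ltNge yx.
  by rewrite prC// prc subrr.
(* A point mass at [c < 0] contradicts nonnegativity of the times, at [c > 0] the chance of covering
   before [c / 2], and at 0 the chance of not covering by a fixed positive time. The test points
   differ from [c], so they carry no mass. *)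
have [c0|c0|c0] := ltgtP c 0.
- have h : c / 2 != c by apply/eqP; lra.
  have := Y1 (c / 2) ltac:(lra); rewrite limit_neg ?atom//; last lra.
  lra.
- have c2 : 0 < c / 2 by lra.
  have [e e0 He] := T_small_likely c2.
  have h : c / 2 != c by apply/eqP; lra.
  have := limit_ge (atom _ h) He; have := Y0 (c / 2) ltac:(lra); lra.
- have [x x0 [e e0 He]] := T_not_small.
  have h : x != c by apply/eqP; lra.
  have := limit_le (atom _ h) He; have := Y1 x ltac:(lra); lra.
Qed.

Lemma limit_support_compact : compact (law_support Y).
Proof.
have [s s0 Hs] := T_bounded.
have [t /andP[st _] Yt] : exists2 t, s < t < s + 1 & Y [set t] = 0%E.
  by apply: non_atom; rewrite ltrDl.
have [u /andP[_ u0] Yu] : exists2 u : R, -1 < u < 0 & Y [set u] = 0%E.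
  by apply: non_atom; rewrite ltrN10.
apply: (@law_support_compact _ _ u t).
  apply/eqP; rewrite eq_le pr_ge0 andbT -(limit_neg u0 Yu); apply: pr_le.
  - by rewrite -[X in measurable X]set_itvNyo; exact: measurable_itv.
  - exact: measurable_Yle.
  - by move=> y /= /ltW.
rewrite pr_Y_gt; apply/eqP; rewrite subr_eq0 eq_le (pr_le1 Y (measurable_Yle t)) andbT.
apply/ler_addgt0Pr => e e0; rewrite -lerBlDr; apply: limit_ge => //.
by apply: Hs => //; exact: ltW.
Qed.

End Subsequence.
End Asymptotics.

Theorem theoremB (R : realType) (b : R) (d : measure_display)
  (Omega : measurableType d) (P : probability Omega R)
  (Rv : nat -> Omega -> nat) (U : nat -> nat -> Omega -> nat)
  (E : nat -> Omega -> R) :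
  -1 < b ->
  (forall n, (0 < n)%N -> covering_model P n Rv (U n) E) ->
  (exists r0 : nat, forall r : nat, (r0 <= r)%N ->
     tailR P Rv r = Num.min ((ln (r%:R : R)) `^ b / r%:R) 1) ->
  (forall eps : R, 0 < eps -> exists M : R, forall n : nat, (0 < n)%N ->
     (P [set w | (M%:E < (tailR P Rv n)%:E * tau n Rv (U n) w)%E] <= eps%:E)%E)
  /\
  (forall (nk : nat -> nat) (Y : probability R R),
     (forall k, (nk k < nk k.+1)%N) ->
     cvg_in_distribution P
       (fun k w => ((tailR P Rv (nk k))%:E * Tcont (nk k) Rv (U (nk k)) E w)%E) Y ->
     non_degenerate Y /\ compact (law_support Y)).
Proof.
move=> b_gt M f_reg; split; first exact: (tau_tight M f_reg).
move=> nk Y nkS cvgY; split.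
  exact: (limit_non_degenerate b_gt M f_reg nkS cvgY).
exact: (limit_support_compact M f_reg nkS cvgY).
Qed.
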